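(* Let $|\psi\rangle$ be an $n$-qubit target state, let $1\le r\le n-1$, $0<\epsilon<1$, $0<\delta<1$, and let $\Omega$ be the strategy operator of the level-$r$ directly partial shadow overlap (DPSO) protocol for $|\psi\rangle$ (with some sampling distributions $p_J$, $q_{\boldsymbol l}$), with spectral gap $\nu(\Omega)>0$. Suppose the device produces i.i.d. copies of a state $\rho$, with either $H_0$: $\langle\psi|\rho|\psi\rangle\le 1-\epsilon$, or $H_1$: $\rho=|\psi\rangle\langle\psi|$. If the number of copies of $\rho$ used is $$N=2^{2r+1}\,\frac{\ln\delta^{-1}}{\nu(\Omega)^2\epsilon^2},$$ then the DPSO protocol accepts the correct one of the hypotheses $H_0$, $H_1$ with probability at least $1-\delta$ (that is, both the Type I and the Type II error are at most $\delta$).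
   Context: One run of the level-$r$ DPSO protocol on one copy of $\rho$: (1) Sample a subset $J=\{j_1,\dots,j_{n-r}\}$ of the $n$ qubits with probability $p_J$; let $K=\{k_1,\dots,k_r\}$ be the complement (write $p_K=p_J$). (2) Sample $\boldsymbol l=(l_1,\dots,l_{n-r})\in\{1,2,3\}^{n-r}$ with probability $q_{\boldsymbol l}$ and measure the Pauli observables $\sigma_{l_1},\dots,\sigma_{l_{n-r}}$ ($\sigma_1=X,\sigma_2=Y,\sigma_3=Z$) on qubits $j_1,\dots,j_{n-r}$, obtaining outcomes $\boldsymbol z=(z_1,\dots,z_{n-r})\in\{\pm1\}^{n-r}$; $|\boldsymbol z\rangle$ denotes the corresponding product eigenvector on $J$. (3) On each qubit of $K$ measure an independently and uniformly chosen Pauli observable among $X,Y,Z$; if $|s_1\rangle,\dots,|s_r\rangle$ are the eigenstates corresponding to the outcomes, form the classical shadow $\hat\zeta_{K,\boldsymbol z}=\bigotimes_{a=1}^r(3|s_a\rangle\langle s_a|-I)$. (4) Compute the reduced target state $|\phi_{K,\boldsymbol z}\rangle=\langle\boldsymbol z|\psi\rangle/\|\langle\boldsymbol z|\psi\rangle\|$ on $K$ (if $\langle\boldsymbol z|\psi\rangle=0$, the projector $|\phi_{K,\boldsymbol z}\rangle\langle\phi_{K,\boldsymbol z}|$ is taken to be $0$). (5) The shadow overlap is $\hat\omega=\mathrm{Tr}\big(\hat\zeta_{K,\boldsymbol z}|\phi_{K,\boldsymbol z}\rangle\langle\phi_{K,\boldsymbol z}|\big)$. DPSO protocol: perform $N$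 independent runs on $N$ copies of $\rho$, giving $\hat\omega_1,\dots,\hat\omega_N$; set $\hat\omega_a=\frac1N\sum_i\hat\omega_i$. If $\hat\omega_a\ge1-\frac12\nu(\Omega)\epsilon$, accept $H_1$ (output ''accept''); otherwise accept $H_0$ (output ''reject''). The Type I error is the probability of accepting $H_1$ when $H_0$ holds, and the Type II error the probability of accepting $H_0$ when $H_1$ holds. Strategy operator: $\Omega=\sum_K\sum_{\boldsymbol l}\sum_{\boldsymbol z}p_Kq_{\boldsymbol l}\,|\boldsymbol z\rangle\langle\boldsymbol z|\otimes|\phi_{K,\boldsymbol z}\rangle\langle\phi_{K,\boldsymbol z}|$, where $|\boldsymbol z\rangle$ runs over the outcomes of measurement $\boldsymbol l$ on $J$. It satisfies $0\le\Omega\le\mathbb 1$ and $\Omega|\psi\rangle=|\psi\rangle$. The spectral gap is $\nu(\Omega)=1-\lambda_2(\Omega)$, where $\lambda_2$ is the second-largest eigenvalue counted with multiplicity. *)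

(* Defs.v *)
(* Mathematical Components with MathComp-Analysis ([R : realType]); the complex
   numbers are [R[i]] from mathcomp-real-closed. *)
From HB Require Import structures.
From mathcomp Require Export all_boot all_order all_algebra.
From mathcomp Require Export spectral complex.
From mathcomp Require Export reals exp.
From mathcomp Require Import ring.

Set Implicit Arguments.
Unset Strict Implicit.
Unset Printing Implicit Defensive.

Import Order.TTheory GRing.Theory Num.Theory.

#[global] Open Scope ring_scope.
#[global] Open Scope sesquilinear_scope.

(* The computational basis of [m] qubits is indexed by [m.-tuple 'I_2]; through
   [enum_rank]/[enum_val] it indexes the rows and columns of matrices of size
   [qdim m], which is 2 ^ m. *)
Notation qdim m := #|{: m.-tuple 'I_2}|.
Notation ket R m := 'cV[R[i]]_(qdim m).
Notation qop R m := 'M[R[i]]_(qdim m).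

Notation subsets n k := {J : {set 'I_n} | #|J| == k}.

Lemma qdimE m : qdim m = (2 ^ m)%N.
Proof. by rewrite card_tuple card_ord. Qed.

Section Quantum.
Variable R : realType.
Local Notation C := R[i].

Definition proj d (v : 'cV[C]_d) : 'M[C]_d := v *m v^t*.

Definition l2norm d (v : 'cV[C]_d) : R := Num.sqrt (complex.Re ((v^t* *m v) 0 0)).

Definition is_pure_state d (v : 'cV[C]_d) : Prop := (v^t* *m v) 0 0 = 1.

(* In the order of [R[i]], [0 <= x] entails that [x] is real. *)
Definition is_density d (rho : 'M[C]_d) : Prop :=
  [/\ rho^t* = rho, forall v : 'cV[C]_d, 0 <= (v^t* *m rho *m v) 0 0
    & \tr rho = 1].

Definition fidelity d (v : 'cV[C]_d) (rho : 'M[C]_d) : R :=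
  complex.Re ((v^t* *m rho *m v) 0 0).

(* X, Y, Z for l = 0, 1, 2 *)
Definition pauli (l : 'I_3) : 'M[C]_2 :=
  \matrix_(i, j) match val l with
    | 0 => (i != j)%:R
    | 1 => if i == j then 0 else (-1) ^+ (i == 0) * 'i%C
    | _ => (-1) ^+ i *+ (i == j)
    end.

(* Outcomes +1 and -1 are encoded as [false] and [true]. *)
Definition pauli_ket (l : 'I_3) (s : bool) : 'cV[C]_2 :=
  \col_i match val l with
    | 0 => ((Num.sqrt 2)^-1)%:C%C * (-1) ^+ (s * i)
    | 1 => ((Num.sqrt 2)^-1)%:C%C * ((-1) ^+ s * 'i%C) ^+ i
    | _ => (i == s :> nat)%:R
    end.

Lemma pauli_ketP l s :
  pauli l *m pauli_ket l s = (-1) ^+ s *: pauli_ket l s.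
Proof.
have ii : 'i%C * 'i%C = -1 :> C by rewrite -expr2 sqr_i.
apply/colP => i; rewrite !mxE !big_ord_recl big_ord0 !mxE /= addr0.
case: l => -[|[|[|]]] //= _; case: s; case: i => -[|[|]] //= _;
  rewrite ?(mul0n, muln0, muln1, expr0, expr1) /=; try ring; ring: ii.
Qed.

Lemma pauli_ket_norm l s : is_pure_state (pauli_ket l s).
Proof.
have ii : 'i%C * 'i%C = -1 :> C by rewrite -expr2 sqr_i.
have ci : ('i%C : C)^* = - 'i%C by apply/eqP; rewrite eq_complex /= oppr0 !eqxx.
set h : C := ((Num.sqrt 2)^-1)%:C%C.
have ch : h^* = h by apply/eqP; rewrite eq_complex /= oppr0 !eqxx.
have hh : 2 * (h * h) = 1.
  rewrite -rmorphM /= -invfM -expr2 sqr_sqrtr ?ler0n// -(rmorph_nat (real_complex R)).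
  by rewrite -rmorphM /= divff ?pnatr_eq0.
rewrite /is_pure_state !mxE !big_ord_recl big_ord0 !mxE /= addr0.
case: l => -[|[|[|]]] //= _; case: s; rewrite ?(mul0n, muln0, muln1) /=;
  rewrite -/h ?(rmorphM, rmorphXn, rmorphN, rmorph1, rmorph0) /=
    ?(expr0, expr1) ?[h^*]ch ?['i%C^*]ci; try ring; try ring: hh; ring: hh ii.
Qed.

Definition qubit_tensor_ket m (v : 'I_m -> 'cV[C]_2) : ket R m :=
  \col_x \prod_(a < m) v a (tnth (enum_val x) a) 0.

Definition qubit_tensor_op m (A : 'I_m -> 'M[C]_2) : qop R m :=
  \matrix_(x, y) \prod_(a < m) A a (tnth (enum_val x) a) (tnth (enum_val y) a).

Definition pauli_product_ket m (l : m.-tuple 'I_3) (z : m.-tuple bool)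
  : ket R m := qubit_tensor_ket (fun a => pauli_ket (tnth l a) (tnth z a)).

(* The bits of [x] at the elements of [J] in increasing order, when #|J| = k *)
Definition restr n k (J : {set 'I_n}) (x : n.-tuple 'I_2) : k.-tuple 'I_2 :=
  [tuple nth ord0 [seq tnth x j | j <- enum J] a | a < k].

(* A (x) B, where A acts on the qubits of [J] and B on those of [~: J] *)
Definition tensor_on n j k (J : {set 'I_n}) (A : qop R j) (B : qop R k)
  : qop R n :=
  \matrix_(x, y)
    (A (enum_rank (restr j J (enum_val x))) (enum_rank (restr j J (enum_val y))) *
     B (enum_rank (restr k (~: J) (enum_val x)))
       (enum_rank (restr k (~: J) (enum_val y)))).

(* <u|psi> on the qubits of [~: J], for u a vector on the qubits of [J] *)
Definition partial_inner n j k (J : {set 'I_n}) (u : ket R j) (psi : ket R n)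
  : ket R k :=
  \col_y \sum_(x : n.-tuple 'I_2 | restr k (~: J) x == enum_val y)
    (u (enum_rank (restr j J x)) 0)^* * psi (enum_rank x) 0.

(* Eigenvalues counted with algebraic multiplicity *)
Definition eigenvalues d (A : 'M[C]_d) : seq C :=
  sval (closed_field_poly_normal (char_poly A)).

(* Only used on Hermitian operators, whose eigenvalues are real *)
Definition lambda2 d (A : 'M[C]_d) : R :=
  nth 0 (sort >=%R [seq complex.Re a | a <- eigenvalues A]) 1.

Definition spectral_gap d (A : 'M[C]_d) : R := 1 - lambda2 A.

Definition is_distribution (T : finType) (p : T -> R) : Prop :=
  (forall x, 0 <= p x) /\ \sum_x p x = 1.

End Quantum.

Section DPSO.
Variables (R : realType) (n r : nat).
Local Notation C := R[i].
Variable psi : ket R n.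
Variable p : subsets n (n - r)%N -> R.
Variable q : (n - r).-tuple 'I_3 -> R.

(* |phi_{K,z}>; it is the zero vector when <z|psi> = 0, as 0^-1 = 0 *)
Definition reduced_target (J : subsets n (n - r)%N) (l : (n - r).-tuple 'I_3)
    (z : (n - r).-tuple bool) : ket R r :=
  let v := partial_inner r (val J) (pauli_product_ket R l z) psi in
  ((l2norm v)^-1)%:C%C *: v.

Definition strategy : qop R n :=
  \sum_(J : subsets n (n - r)%N) \sum_(l : (n - r).-tuple 'I_3)
    \sum_(z : (n - r).-tuple bool)
      (p J * q l)%:C%C *:
        tensor_on (val J) (proj (pauli_product_ket R l z))
                  (proj (reduced_target J l z)).

(* The record (J, l, z, b, s) of one run: on the qubits of J the Paulis l are
   measured with outcomes z, on those of K = ~: J the Paulis b with outcomes s. *)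
Definition run : finType :=
  (subsets n (n - r)%N * (n - r).-tuple 'I_3 * (n - r).-tuple bool
   * r.-tuple 'I_3 * r.-tuple bool)%type.

(* The outcomes (z, s) follow the Born rule. *)
Definition run_prob (rho : qop R n) (w : run) : R :=
  let: (J, l, z, b, s) := w in
  p J * q l * (3^-1) ^+ r *
  complex.Re (\tr (rho *m tensor_on (val J) (proj (pauli_product_ket R l z))
                                    (proj (pauli_product_ket R b s)))).

Definition classical_shadow (b : r.-tuple 'I_3) (s : r.-tuple bool) : qop R r :=
  qubit_tensor_op
    (fun a => 3 *: proj (pauli_ket R (tnth b a) (tnth s a)) - 1%:M).

Definition shadow_overlap (w : run) : R :=
  let: (J, l, z, b, s) := w in
  complex.Re (\tr (classical_shadow b s *m proj (reduced_target J l z))).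

Definition runs_prob (rho : qop R n) N (w : N.-tuple run) : R :=
  \prod_(i < N) run_prob rho (tnth w i).

Definition accepts (eps : R) N (w : N.-tuple run) : bool :=
  1 - 2^-1 * spectral_gap strategy * eps
    <= N%:R^-1 * \sum_(i < N) shadow_overlap (tnth w i).

Definition prob_accept (rho : qop R n) (eps : R) (N : nat) : R :=
  \sum_(w : N.-tuple run | accepts eps w) runs_prob rho w.

Definition prob_reject (rho : qop R n) (eps : R) (N : nat) : R :=
  \sum_(w : N.-tuple run | ~~ accepts eps w) runs_prob rho w.

End DPSO.

(* Main.v *)
(** The empirical mean of the overlap is compared with the threshold by a Chernoff
    bound with variance proxy 4^(r-1).  The range of the overlap, [-2^(r-1), 2^r],
    is too wide for Hoeffding's inequality to give the stated number of copies;
    instead the second moment is used.  By induction on the qubits, |Tr(zeta X)|^2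
    has mean at most (12/7)^r times the squared Frobenius norm of X, for every
    operator X and every state of K; together with exp x <= 1 + x + 2/3 x^2 for
    |x| <= 3/4, this gives the sub-Gaussian bound when r >= 2.  When r = 1 the
    overlap is centred at 1/2: the square of the centred overlap is at most 9/4 and
    has mean at most 3/4, which is exactly what is needed.

    The classical shadow is unbiased, so the mean of the overlap is Tr(rho Omega).
    As Omega fixes psi and has gap nu > 0, the eigenvalue 1 is simple and all the
    others are at most 1 - nu, whence Tr(rho Omega) <= 1 - nu eps under H_0. *)
Require Import Defs.
From mathcomp Require Import classical_sets topology normedtype sequences derive realfun.
From mathcomp Require Import ring lra.

Set Implicit Arguments.
Unset Strict Implicit.
Unset Printing Implicit Defensive.

Import Order.TTheory GRing.Theory Num.Theory.
Import numFieldNormedType.Exports.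

(** * Sub-Gaussian tail bounds *)

Lemma is_derive_continuous (R : realType) (h h' : R -> R) :
  (forall y : R, is_derive y 1 h (h' y)) -> continuous h.
Proof.
by move=> dh y; apply/differentiable_continuous/derivable1_diffP/ex_derive.
Qed.

(** After multiplication by [expR (- x)], a polynomial comparison becomes a monotonicity statement
    for a function [h] with [h 0 = 1], and the mean value theorem reads the sign off its
    derivative. *)
Lemma le_expR_quadratic (R : realType) (x : R) :
  `|x| <= 3 / 4 -> expR x <= 1 + x + 2 / 3 * x ^+ 2.
Proof.
move=> hx; have {hx} [hx1 hx2] : - (3 / 4) <= x /\ x <= 3 / 4.
  by apply/andP; rewrite -ler_norml.
have key (q : R) : 1 <= expR (- x) * q -> expR x <= q.
  by rewrite expRN -ler_pdivrMl ?invr_gt0 ?expR_gt0// invrK mulr1.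
have [x0|x0|->] := ltrgt0P x; last by rewrite expR0 expr0n/= mulr0 !addr0.
  (* The Taylor coefficient 1/24 is raised to 1/19. The derivative of [h] then has the sign of 5/6 -
     y, positive up to 3/4, while 1/2 + x/6 + x^2/19 stays below 2/3 there. *)
  apply: (@le_trans _ _ (1 + x + x ^+ 2 / 2 + x ^+ 3 / 6 + x ^+ 4 / 19)); last first.
    have -> : x ^+ 4 = x ^+ 2 * (x * x) by ring.
    have -> : x ^+ 3 = x ^+ 2 * x by ring.
    have : x * x <= 9 / 16 by nra.
    have := sqr_ge0 x; nra.
  apply: key.
  pose h (y : R) :=
    expR (- y) * (1 + y + y ^+ 2 / 2 + y ^+ 3 / 6 + y ^+ 4 / 19).
  have dh (y : R) : is_derive y 1 h
      (expR (- y) * (y ^+ 3 * (5 / 114 - y / 19))).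
    apply: is_derive_eq; rewrite /GRing.scale /=; set e := expR _.
    by field.
  have [c] := @MVT R h _ 0 x x0 (fun y _ => dh y)
    (continuous_subspaceT (is_derive_continuous dh)).
  rewrite in_itv /= => /andP[c0 cx].
  have -> : h 0 = 1 by rewrite /h oppr0 expR0 !expr0n/= !mul0r !addr0 mulr1.
  rewrite -/(h x) -subr_ge0 => ->.
  rewrite !mulr_ge0 ?expR_ge0 ?exprn_ge0 ?(ltW c0)//; lra.
(* For negative x the Taylor polynomial of degree 2 already dominates: [h] is now nonincreasing, so
   [h x] is at least [h 0]. *)
apply: (@le_trans _ _ (1 + x + x ^+ 2 / 2)); last by have := sqr_ge0 x; lra.
apply: key.
pose h (y : R) := expR (- y) * (1 + y + y ^+ 2 / 2).
have dh (y : R) : is_derive y 1 h (- (expR (- y) * (y ^+ 2 / 2))).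
  apply: is_derive_eq; rewrite /GRing.scale /=; set e := expR _.
  by field.
have [c _] := @MVT R h _ x 0 x0 (fun y _ => dh y)
  (continuous_subspaceT (is_derive_continuous dh)).
have -> : h 0 = 1 by rewrite /h oppr0 expR0 expr0n/= mul0r !addr0 mulr1.
rewrite -/(h x) -subr_le0 => ->.
rewrite sub0r mulrNN mulr_ge0_le0 ?(ltW x0)// mulr_ge0 ?expR_ge0//.
by rewrite divr_ge0 ?sqr_ge0.
Qed.

Lemma sum_tuple_prod (S : comPzRingType) (T : finType) m (F : 'I_m -> T -> S) :
  \sum_(w : m.-tuple T) \prod_a F a (tnth w a) = \prod_a \sum_t F a t.
Proof.
rewrite (bigA_distr_bigA F) /=.
rewrite (reindex (fun f : {ffun 'I_m -> T} => [tuple f i | i < m])) /=.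
  by apply: eq_bigr => f _; apply: eq_bigr => i _; rewrite tnth_mktuple.
exists (fun w : m.-tuple T => [ffun i => tnth w i]) => [f _|w _].
  by apply/ffunP => i; rewrite ffunE tnth_mktuple.
by apply: eq_from_tnth => i; rewrite tnth_mktuple ffunE.
Qed.

Lemma prod_distr_tuple (R : comPzRingType) (T : finType) N (F : T -> R) :
  \sum_(w : N.-tuple T) \prod_(i < N) F (tnth w i) = (\sum_x F x) ^+ N.
Proof. by rewrite (sum_tuple_prod (fun _ => F)) prodr_const card_ord. Qed.

Section Chernoff.
Variables (R : realType) (T : finType) (P : T -> R).
Hypothesis Pge0 : forall x, 0 <= P x.

(** Exponential Markov inequality: on [A] the factor exp(sum of [Z]) is at least 1, and over all
    tuples the weighted sum factorises by independence. *)
Lemma chernoff_bound N (Z : T -> R) (A : pred (N.-tuple T)) :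
  (forall w, A w -> 0 <= \sum_(i < N) Z (tnth w i)) ->
  \sum_(w | A w) \prod_(i < N) P (tnth w i) <= (\sum_x P x * expR (Z x)) ^+ N.
Proof.
move=> hA; rewrite -prod_distr_tuple [leRHS](bigID A) /= -[leLHS]addr0.
apply: lerD; last first.
  by apply: sumr_ge0 => w _; apply: prodr_ge0 => i _; rewrite mulr_ge0 ?expR_ge0.
apply: ler_sum => w Aw; rewrite big_split /= -expR_sum.
rewrite ler_peMr ?prodr_ge0// -expR0 ler_expR; exact: hA.
Qed.

(** The quadratic coefficient 2/3 times the second-moment bound 3/4 [s2] gives the Gaussian exponent
    [lam ^+ 2 * s2 / 2]; then 1 + y <= exp y. *)
Lemma subgaussian_mgf (c : R) (lam s2 : R) (Y : T -> R) :
  \sum_x P x = 1 ->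
  0 <= lam ->
  (forall x, lam * `|Y x| <= 3 / 4) ->
  \sum_x P x * Y x ^+ 2 <= 3 / 4 * s2 ->
  \sum_x P x * expR (lam * (Y x - c)) <=
    expR (lam * (\sum_x P x * Y x - c) + lam ^+ 2 * s2 / 2).
Proof.
move=> P1 lam0 hY hV.
under eq_bigr => x _ do rewrite mulrBr expRD mulrA.
rewrite -mulr_suml [in leRHS]mulrBr -addrA [- _ + _]addrC addrA expRD.
rewrite ler_wpM2r ?expR_ge0//.
apply: (@le_trans _ _ (\sum_x P x * (1 + lam * Y x + 2 / 3 * (lam * Y x) ^+ 2))).
  apply: ler_sum => x _; apply: ler_wpM2l => //.
  by apply: le_expR_quadratic; rewrite normrM ger0_norm.
apply: le_trans (expR_ge1Dx _).
have -> : \sum_x P x * (1 + lam * Y x + 2 / 3 * (lam * Y x) ^+ 2) =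
  1 + lam * (\sum_x P x * Y x) + 2 / 3 * lam ^+ 2 * (\sum_x P x * Y x ^+ 2).
  rewrite -[X in X + _ + _]P1 !mulr_sumr -!big_split /=.
  by apply: eq_bigr => x _; ring.
rewrite -!addrA lerD2l lerD2l.
have := sqr_ge0 lam; nra.
Qed.

(* [t] is the deviation of the empirical mean from the true one; the exponent
   is optimised at [lam = t / s2]. *)
Lemma subgaussian_tail N (c t s2 : R) (Y : T -> R) (A : pred (N.-tuple T)) :
  \sum_x P x = 1 ->
  0 <= t -> 0 < s2 ->
  (forall x, t / s2 * `|Y x| <= 3 / 4) ->
  \sum_x P x * Y x ^+ 2 <= 3 / 4 * s2 ->
  \sum_x P x * Y x <= c - t ->
  (forall w, A w -> N%:R * c <= \sum_(i < N) Y (tnth w i)) ->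
  \sum_(w | A w) \prod_(i < N) P (tnth w i) <= expR (- (N%:R * (t ^+ 2 / (2 * s2)))).
Proof.
move=> P1 t0 s0 hY hV hm hA.
have l0 : 0 <= t / s2 by rewrite divr_ge0 ?(ltW s0).
apply: le_trans (@chernoff_bound N (fun x => t / s2 * (Y x - c)) A _) _.
  move=> w Aw; rewrite -mulr_sumr mulr_ge0// sumrB subr_ge0.
  by rewrite sumr_const card_ord -mulr_natl hA.
rewrite -mulrN expRM_natl; apply: lerXn2r; rewrite ?nnegrE ?expR_ge0//.
  by apply: sumr_ge0 => x _; rewrite mulr_ge0 ?expR_ge0.
apply: le_trans (subgaussian_mgf c P1 l0 hY hV) _.
rewrite ler_expR.
have -> : - (t ^+ 2 / (2 * s2)) = t / s2 * (- t) + (t / s2) ^+ 2 * s2 / 2.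
  by field; rewrite gt_eqF.
by rewrite lerD2r ler_wpM2l// lerBlDr addrC.
Qed.

End Chernoff.

(** * Contraction of the measured qubits *)

Lemma adjmxM (C : numClosedFieldType) m n p (A : 'M[C]_(m, n)) (B : 'M_(n, p)) :
  (A *m B)^t* = B^t* *m A^t*.
Proof. by rewrite trmx_mul map_mxM. Qed.

Section Slice.
Variable R : realType.
Local Notation C := R[i].

Definition psd d (A : 'M[C]_d) := forall v : 'cV[C]_d, 0 <= (v^t* *m A *m v) 0 0.

Lemma psd_conj d e (A : 'M[C]_d) (W : 'M_(e, d)) : psd A -> psd (W *m A *m W^t*).
Proof.
move=> hA v; have := hA (W^t* *m v).
by rewrite adjmxM trmxCK !mulmxA.
Qed.

Lemma psd_proj d (v : 'cV[C]_d) : psd (proj v).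
Proof.
move=> u; rewrite /proj !mulmxA -mulmxA.
have -> : v^t* *m u = (u^t* *m v)^t* by rewrite adjmxM trmxCK.
by rewrite [X in 0 <= X]mxE big_ord1 !mxE mul_conjC_ge0.
Qed.

Lemma proj_herm d (v : 'cV[C]_d) : (proj v)^t* = proj v.
Proof. by rewrite /proj adjmxM trmxCK. Qed.

Lemma mxtrace_proj d (A : 'M[C]_d) (v : 'cV_d) :
  \tr (A *m proj v) = (v^t* *m A *m v) 0 0.
Proof. by rewrite /proj mulmxA mxtrace_mulC mulmxA trace_mx11. Qed.

(* <u| (x) 1 *)
Definition slice n j k (J : {set 'I_n}) (u : ket R j) : 'M[C]_(qdim k, qdim n) :=
  \matrix_(y, x) ((u (enum_rank (restr j J (enum_val x))) 0)^*
    *+ (restr k (~: J) (enum_val x) == enum_val y)).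

Lemma partial_innerE n j k (J : {set 'I_n}) (u : ket R j) (psi : ket R n) :
  partial_inner k J u psi = slice k J u *m psi.
Proof.
apply/colP => y; rewrite !mxE (reindex_onto enum_rank enum_val) /=; last first.
  by move=> x _; rewrite enum_valK.
rewrite big_mkcond [RHS]big_mkcond /=; apply: eq_bigr => x _; rewrite mxE.
rewrite enum_rankK eqxx.
by case: ifP => //= _; rewrite ?mulr1n ?mulr0n ?mul0r.
Qed.

(** This factorisation moves every trace against [rho] down to K, where the unnormalised state left
    after outcome u is W rho W^* with W = [slice k J u]. *)
Lemma tensor_on_projE n j k (J : {set 'I_n}) (u : ket R j) (B : qop R k) :
  tensor_on J (proj u) B = (slice k J u)^t* *m B *m slice k J u.
Proof.
apply/matrixP => x x'; rewrite !mxE big_ord1 !mxE.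
rewrite (bigD1 (enum_rank (restr k (~: J) (enum_val x')))) //= big1 ?addr0; last first.
  move=> y yx; rewrite [X in _ * X]mxE.
  case: (restr k (~: J) (enum_val x') =P enum_val y) => [e|_]; last by rewrite mulr0.
  by rewrite e enum_valK eqxx in yx.
rewrite mxE (bigD1 (enum_rank (restr k (~: J) (enum_val x)))) //= big1 ?addr0; last first.
  move=> y yx; rewrite !mxE.
  case: (restr k (~: J) (enum_val x) =P enum_val y) => [e|_]; last by rewrite conjC0 mul0r.
  by rewrite e enum_valK eqxx in yx.
rewrite !mxE !enum_rankK !eqxx !mulr1n conjCK.
by rewrite mulrAC.
Qed.

Lemma restr_inj n j (J : {set 'I_n}) (x y : n.-tuple 'I_2) :
  #|J| = j -> restr j J x = restr j J y -> {in J, tnth x =1 tnth y}.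
Proof.
move=> cJ e i iJ.
have ie : i \in enum J by rewrite mem_enum.
have lt : (index i (enum J) < j)%N by rewrite -cJ cardE index_mem.
have := congr1 (fun t => tnth t (Ordinal lt)) e.
by rewrite !tnth_mktuple !(nth_map i) -?cardE ?cJ // nth_index.
Qed.

(** Completeness on J lifts to all n qubits because a bit string is determined by its restrictions
    to J and to the complement of J. *)
Lemma sum_slice n j k (J : {set 'I_n}) (T : finType) (u : T -> ket R j) :
  #|J| = j -> #|~: J| = k -> \sum_z proj (u z) = 1%:M ->
  \sum_z (slice k J (u z))^t* *m slice k J (u z) = 1%:M.
Proof.
move=> cJ cK hu.
have -> : \sum_z (slice k J (u z))^t* *m slice k J (u z) =
    tensor_on J (1%:M : qop R j) (1%:M : qop R k).
  rewrite -hu; apply/matrixP => x y; rewrite summxE mxE summxE mulr_suml.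
  by apply: eq_bigr => z _; rewrite -[X in X *m _]mulmx1 -tensor_on_projE mxE.
apply/matrixP => x y; rewrite !mxE -natrM mulnb.
congr (nat_of_bool _)%:R; apply/andP/eqP => [[]|->]; last by rewrite !eqxx.
move=> /eqP /enum_rank_inj eJ /eqP /enum_rank_inj eK.
apply: enum_val_inj; apply: eq_from_tnth => i.
have [iJ|iJ] := boolP (i \in J); first exact: (restr_inj cJ eJ).
by apply: (restr_inj cK eK); rewrite inE.
Qed.

End Slice.

(** * Second moment of the classical shadow *)

Section Bloch.
Variables (F : numFieldType) (A : 'M[F]_2).
(** When [A] is a Pauli matrix this is the eigenprojector of outcome [s]. *)
Let P (s : bool) := 2^-1 *: (1%:M + (-1) ^+ s *: A).

Lemma bloch_sum : \sum_s P s = 1%:M.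
Proof.
rewrite big_bool /=; apply/matrixP => i j; rewrite !mxE expr0 expr1.
by move: (i == j)%:R => a; field.
Qed.

Lemma bloch_shadow_sum i j i' j' :
  \sum_s P s i j * (3 *: P s - 1%:M) i' j' =
  2^-1 * ((i == j)%:R * (i' == j')%:R + 3 * (A i j * A i' j')).
Proof.
rewrite big_bool /= !mxE expr0 expr1.
by move: (i == j)%:R (i' == j')%:R => a b; field.
Qed.

Lemma bloch_weight (tau : 'I_2 -> 'I_2 -> F) s :
  \sum_i \sum_j tau i j * P s j i =
  2^-1 * (tau 0 0 + tau 1 1 + (-1) ^+ s * \sum_i \sum_j tau i j * A j i).
Proof.
rewrite !big_ord_recl !big_ord0 /= (_ : lift ord0 ord0 = 1); last exact: val_inj.
rewrite (_ : ord0 = 0) // !mxE /= ?mulr0n ?mulr1n.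
by move: ((-1) ^+ s) => e; field.
Qed.

Lemma bloch_shadow (x : 'I_2 -> 'I_2 -> F) s :
  \sum_i \sum_j (3 *: P s - 1%:M) i j * x j i =
  2^-1 * (x 0 0 + x 1 1 + 3 * (-1) ^+ s * \sum_i \sum_j x i j * A j i).
Proof.
rewrite !big_ord_recl !big_ord0 /= (_ : lift ord0 ord0 = 1); last exact: val_inj.
rewrite (_ : ord0 = 0) // !mxE /= ?mulr0n ?mulr1n.
by move: ((-1) ^+ s) => e; field.
Qed.

(** Scalar form of the sum over the three Paulis: the identity terms cancel and only the swap term
    survives. *)
Lemma bloch_swap (a b c d : F) :
  2^-1 * (a * b *+ 3 + 3 * (2 * c * d - a * b)) = 3 * (c * d).
Proof. by field. Qed.

End Bloch.

Section Qubit.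
Variable R : realType.
Local Notation C := R[i].

Lemma proj_pauli_ket (l : 'I_3) (s : bool) :
  proj (pauli_ket R l s) = 2^-1 *: (1%:M + (-1) ^+ s *: pauli R l).
Proof.
have ii : 'i%C * 'i%C = -1 :> C by rewrite -expr2 sqr_i.
have ci : ('i%C : C)^* = - 'i%C by apply/eqP; rewrite eq_complex /= oppr0 !eqxx.
set h : C := ((Num.sqrt 2)^-1)%:C%C.
have ch : h^* = h by apply/eqP; rewrite eq_complex /= oppr0 !eqxx.
have hh : h * h = 2^-1.
  rewrite -rmorphM /= -invfM -expr2 sqr_sqrtr ?ler0n//.
  by rewrite fmorphV rmorph_nat.
apply/matrixP => i j; rewrite !mxE !big_ord_recl big_ord0 !mxE /= addr0.
case: l => -[|[|[|]]] //= _; case: s; case: i => -[|[|]] //= ?;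
  case: j => -[|[|]] //= ?; rewrite ?(mul0n, muln0, muln1) /=;
  rewrite -/h ?(rmorphM, rmorphXn, rmorphN, rmorph1, rmorph0) /=
    ?(expr0, expr1) ?[h^*]ch ?['i%C^*]ci ?rmorph1 ?rmorph0 ?expr0 ?expr1 /= ?mulr0n ?mulr1n;
  try (rewrite -hh; ring); try (rewrite -hh; ring: ii);
  by rewrite ?mulrNN !mulr1 -[1 + 1]/(2%:R : C) mulVf ?pnatr_eq0.
Qed.

Lemma sum_proj_pauli_ket (l : 'I_3) : \sum_s proj (pauli_ket R l s) = 1%:M.
Proof.
by under eq_bigr => s _ do rewrite proj_pauli_ket; rewrite bloch_sum.
Qed.

(** Entrywise form of XX + YY + ZZ = 2 SWAP - 1 on two qubits. *)
Lemma sum_pauli_swap (i j i' j' : 'I_2) :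
  \sum_l pauli R l i j * pauli R l i' j' =
  2 * (i == j')%:R * (j == i')%:R - (i == j)%:R * (i' == j')%:R.
Proof.
have ii : 'i%C * 'i%C = -1 :> C by rewrite -expr2 sqr_i.
rewrite !big_ord_recl big_ord0 !mxE /= addr0.
case: i => -[|[|]] //= ?; case: j => -[|[|]] //= ?;
case: i' => -[|[|]] //= ?; case: j' => -[|[|]] //= ?;
  rewrite ?mulr0n ?mulr1n ?expr0 ?expr1; try ring; ring: ii.
Qed.

(** One-qubit unbiasedness: the sum of projector (x) shadow is 3 SWAP, and pairing SWAP with A (x) X
    gives Tr(A X). The factor 3 counts the measurement settings. *)
Lemma sum_shadow_swap (i j i' j' : 'I_2) :
  \sum_l \sum_s proj (pauli_ket R l s) i j *
    (3 *: proj (pauli_ket R l s) - 1%:M) i' j' =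
  3 * ((i == j')%:R * (j == i')%:R).
Proof.
have -> : 3 * ((i == j')%:R * (j == i')%:R) =
  \sum_(l : 'I_3) 2^-1 * ((i == j)%:R * (i' == j')%:R
     + 3 * (pauli R l i j * pauli R l i' j')) :> C.
  rewrite -mulr_sumr big_split /= sumr_const card_ord -[X in _ + X]mulr_sumr.
  by rewrite sum_pauli_swap bloch_swap.
apply: eq_bigr => l _; rewrite -bloch_shadow_sum.
by apply: eq_bigr => s _; rewrite proj_pauli_ket.
Qed.

Lemma sum_pauli (tau : 'I_2 -> 'I_2 -> C) (l : 'I_3) :
  \sum_i \sum_j tau i j * pauli R l j i =
  match val l with
  | 0 => tau 0 1 + tau 1 0
  | 1 => 'i%C * (tau 0 1 - tau 1 0)
  | _ => tau 0 0 - tau 1 1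
  end.
Proof.
rewrite !big_ord_recl !big_ord0 /= (_ : lift ord0 ord0 = 1); last exact: val_inj.
rewrite (_ : ord0 = 0) // !mxE /= ?mulr0n ?mulr1n ?expr0 ?expr1.
by case: l => -[|[|[|]]] //= _; ring.
Qed.

End Qubit.

(** * Second moment for one qubit *)

Section SecondMoment.
Variable R : realType.
Local Notation C := R[i].

Definition normsq (z : C) : R := complex.Re z ^+ 2 + complex.Im z ^+ 2.

Lemma ge0_Re (z : C) : 0 <= z -> 0 <= complex.Re z.
Proof. by case: z => a b; rewrite lecE /= => /andP[]. Qed.

Lemma ReD (x y : C) : complex.Re (x + y) = complex.Re x + complex.Re y.
Proof. by case: x; case: y. Qed.

(** The right-hand side is Re Tr(tau M^2) for the Hermitian M = u + t1 X + t2 Y + t3 Z. It is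
    nonnegative because M^2 is the sum of v v^* over the columns v of M, which are the two test
    vectors. *)
Lemma bloch_positive (tau : 'I_2 -> 'I_2 -> C) (u t1 t2 t3 : R) :
  (forall v : 'I_2 -> C, 0 <= \sum_i \sum_j (v i)^* * tau i j * v j) ->
  0 <= complex.Re (tau 0 0 + tau 1 1) * (u ^+ 2 + t1 ^+ 2 + t2 ^+ 2 + t3 ^+ 2)
     + 2 * u * (complex.Re (tau 0 1 + tau 1 0) * t1
                + (complex.Im (tau 1 0) - complex.Im (tau 0 1)) * t2
                + complex.Re (tau 0 0 - tau 1 1) * t3).
Proof.
move=> h.
have := h (fun i => if i == 0 then (u + t3)%:C%C else (t1 +i* t2)%C).
have := h (fun i => if i == 0 then (t1 -i* t2)%C else (u - t3)%:C%C).
rewrite !big_ord_recl !big_ord0 /=.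
rewrite (_ : lift ord0 ord0 = 1); last exact: val_inj.
move: (tau 0 0) (tau 0 1) (tau 1 0) (tau 1 1) => [a a'] [b b'] [c c'] [d d'].
move=> /ge0_Re /= H1 /ge0_Re /= H2.
have := addr_ge0 H1 H2. lra.
Qed.

Lemma psd_trace1 (tau : 'I_2 -> 'I_2 -> C) :
  (forall v : 'I_2 -> C, 0 <= \sum_i \sum_j (v i)^* * tau i j * v j) ->
  0 <= complex.Re (tau 0 0 + tau 1 1).
Proof.
move=> /bloch_positive -/(_ 1 0 0 0).
by rewrite expr1n expr0n /= !mulr0 !addr0 !mulr0 !addr0 mulr1.
Qed.

(* In Pauli coordinates of [x], the difference of the two sides is a sum of
   [bloch_positive] terms; 12/7 is a rational upper bound for the optimal
   constant [1 + 1 / sqrt 2]. *)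
Lemma second_moment1 (tau x : 'I_2 -> 'I_2 -> C) :
  (forall v : 'I_2 -> C, 0 <= \sum_i \sum_j (v i)^* * tau i j * v j) ->
  \sum_l \sum_s complex.Re (\sum_i \sum_j tau i j * proj (pauli_ket R l s) j i)
     * normsq (\sum_i \sum_j (3 *: proj (pauli_ket R l s) - 1%:M) i j * x j i)
  <= 3 * (12 / 7) * complex.Re (tau 0 0 + tau 1 1) * \sum_i \sum_j normsq (x i j).
Proof.
move=> h; have T0 := psd_trace1 h; have hb := bloch_positive _ _ _ _ h.
under eq_bigr => l _ do (under eq_bigr => s _ do
  rewrite proj_pauli_ket bloch_weight bloch_shadow !sum_pauli).
rewrite !big_ord_recl !big_ord0 !big_bool /=.
rewrite (_ : lift ord0 ord0 = 1); last exact: val_inj.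
rewrite (_ : ord0 = 0) // expr0 expr1.
have -> : 2^-1 = (2^-1)%:C%C :> C by rewrite fmorphV rmorph_nat.
have -> : 3 = 3%:C%C :> C by rewrite rmorph_nat.
move: T0 hb.
move: (tau 0 0) (tau 0 1) (tau 1 0) (tau 1 1) => [a a'] [b b'] [c c'] [d d'].
move: (x 0 0) (x 0 1) (x 1 0) (x 1 1) => [x0 y0] [x1 y1] [x2 y2] [x3 y3].
rewrite /normsq /= => T0 hb.
(* Write x = c0 + c1 X + c2 Y + c3 Z and T = Re Tr tau. The real parts of the coordinates enter
   [H1], the imaginary parts [H2]. Taken 9/7 times, these use up all the slack in |c1|^2 + |c2|^2 +
   |c3|^2, and -7/3 is the factor that matches the cross term -6 c0; what is left is (2/7) T |c0|^2,
   covered by [H3] and [H4]. *)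
have H1 := hb (- (7 / 3) * ((x0 + x3) / 2)) ((x1 + x2) / 2) ((y2 - y1) / 2) ((x0 - x3) / 2).
have H2 := hb (- (7 / 3) * ((y0 + y3) / 2)) ((y1 + y2) / 2) ((x1 - x2) / 2) ((y0 - y3) / 2).
have H3 := mulr_ge0 T0 (sqr_ge0 (x0 + x3)).
have H4 := mulr_ge0 T0 (sqr_ge0 (y0 + y3)).
lra.
Qed.
End SecondMoment.

Lemma big_tuple_cons (V : nmodType) (T : finType) m (F : m.+1.-tuple T -> V) :
  \sum_w F w = \sum_t \sum_(w : m.-tuple T) F (cons_tuple t w).
Proof.
rewrite pair_big /= (reindex (fun p : T * m.-tuple T => cons_tuple p.1 p.2)) //=.
exists (fun w => (thead w, [tuple of behead w])) => [[t w] _|w _] /=.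
  by rewrite theadE; congr (_, _); apply: val_inj.
by rewrite [RHS]tuple_eta; apply: val_inj.
Qed.

Lemma big_tuple_nil (V : nmodType) (T : finType) (F : 0.-tuple T -> V) :
  \sum_w F w = F [tuple].
Proof.
by rewrite (bigD1 [tuple]) //= big1 ?addr0// => w /eqP[]; exact: tuple0.
Qed.

Lemma exchange_sum4 (V : nmodType) (I J K L : finType) (F : I -> K -> J -> L -> V) :
  \sum_i \sum_k \sum_j \sum_l F i k j l = \sum_k \sum_l \sum_i \sum_j F i k j l.
Proof.
rewrite exchange_big; apply: eq_bigr => k _ /=.
under eq_bigr => i _ do rewrite exchange_big.
exact: exchange_big.
Qed.

Section SecondMoment.
Variable R : realType.
Local Notation C := R[i].

(** Positivity for kernels indexed by tuples instead of ordinals, so that the first qubit can be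
    split off with [cons_tuple]. *)
Definition psdf (T : finType) (sigma : T -> T -> C) :=
  forall v : T -> C, 0 <= \sum_x \sum_y (v x)^* * sigma x y * v y.

Lemma ReX (T : finType) (F : T -> C) : complex.Re (\sum_x F x) = \sum_x complex.Re (F x).
Proof. exact: (big_morph _ (@ReD R)). Qed.

Variables (m : nat) (sigma : m.+1.-tuple 'I_2 -> m.+1.-tuple 'I_2 -> C).
Hypothesis sigma_psd : psdf sigma.

(** The partial trace over all qubits but the first is positive: sum the form of [sigma] over the
    test vectors v (x) |z>. *)
Lemma psdf_head :
  psdf (fun i j => \sum_(x : m.-tuple 'I_2) sigma (cons_tuple i x) (cons_tuple j x)).
Proof.
move=> v.
have -> : \sum_i \sum_j (v i)^* * (\sum_(x : m.-tuple 'I_2)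
    sigma (cons_tuple i x) (cons_tuple j x)) * v j =
  \sum_(z : m.-tuple 'I_2) \sum_x \sum_y
   (v (thead x) *+ ([tuple of behead x] == z))^* * sigma x y *
   (v (thead y) *+ ([tuple of behead y] == z)).
  rewrite [RHS](_ : _ = \sum_(z : m.-tuple 'I_2) \sum_i \sum_j
    (v i)^* * sigma (cons_tuple i z) (cons_tuple j z) * v j); last first.
    apply: eq_bigr => z _; rewrite big_tuple_cons; apply: eq_bigr => i _.
    rewrite (bigD1 z) //= [X in _ + X]big1 ?addr0; last first.
      move=> x xz; apply: big1 => y _; rewrite (_ : [tuple of _] = x); last exact: val_inj.
      by rewrite (negbTE xz) mulr0n conjC0 !mul0r.
    rewrite big_tuple_cons; apply: eq_bigr => j _.
    rewrite (bigD1 z) //= [X in _ + X]big1 ?addr0; last first.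
      move=> y yz.
      rewrite (_ : ([tuple of behead (cons_tuple j y)] == z) = false) ?mulr0n ?mulr0//.
      by apply: contraNF yz => /eqP <-; apply/eqP/val_inj.
    rewrite !theadE.
    have e t : [tuple of behead (cons_tuple t z)] == z by apply/eqP/val_inj.
    by rewrite !e !mulr1n.
  rewrite [RHS]exchange_big; apply: eq_bigr => i _.
  rewrite exchange_big; apply: eq_bigr => j _.
  by rewrite mulr_sumr mulr_suml.
by apply: sumr_ge0 => z _; apply: sigma_psd.
Qed.

(** The unnormalised state left after projecting the first qubit on [k] is positive: test [sigma] on
    k (x) v. *)
Lemma psdf_tail (k : 'cV[C]_2) :
  psdf (fun x y : m.-tuple 'I_2 =>
    \sum_i \sum_j sigma (cons_tuple i x) (cons_tuple j y) * proj k j i).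
Proof.
move=> v.
have := sigma_psd (fun x => k (thead x) 0 * v [tuple of behead x]).
rewrite big_tuple_cons.
under eq_bigr => i _ do (under eq_bigr => x _ do rewrite big_tuple_cons).
rewrite exchange_sum4.
congr (_ <= _); apply: eq_bigr => x _; apply: eq_bigr => y _.
rewrite mulr_sumr mulr_suml; apply: eq_bigr => i _.
rewrite mulr_sumr mulr_suml; apply: eq_bigr => j _.
have e t w : [tuple of behead (cons_tuple t w)] = w :> m.-tuple 'I_2 by apply: val_inj.
rewrite !e !theadE rmorphM mxE big_ord1 !mxE.
by move: (k i 0) (k j 0) => a b; ring.
Qed.

End SecondMoment.

Lemma exchange_sum22 (V : nmodType) (I J K L : finType) (F : I -> J -> K -> L -> V) :
  \sum_i \sum_j \sum_k \sum_l F i j k l = \sum_k \sum_l \sum_i \sum_j F i j k l.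
Proof.
under eq_bigr => i _ do rewrite exchange_big.
rewrite exchange_big; apply: eq_bigr => k _ /=.
under eq_bigr => i _ do rewrite exchange_big.
exact: exchange_big.
Qed.

(** * Second moment for several qubits *)

Section Shadows.
Variable R : realType.
Local Notation C := R[i].

Definition tensor_entry m (A : 'I_m -> 'M[C]_2) (x y : m.-tuple 'I_2) : C :=
  \prod_(a < m) A a (tnth x a) (tnth y a).

Definition outcome_proj m (b : m.-tuple 'I_3) (s : m.-tuple bool) (a : 'I_m) :=
  proj (pauli_ket R (tnth b a) (tnth s a)).

Definition shadow1 m (b : m.-tuple 'I_3) (s : m.-tuple bool) (a : 'I_m) :=
  3 *: outcome_proj b s a - 1%:M.

Lemma tensor_entry_cons m (A : 'I_m.+1 -> 'M[C]_2) i j x y :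
  tensor_entry A (cons_tuple i x) (cons_tuple j y) =
  A ord0 i j * tensor_entry (fun a => A (lift ord0 a)) x y.
Proof.
rewrite /tensor_entry big_ord_recl !tnth0; congr (_ * _).
by apply: eq_bigr => a _; rewrite !tnthS.
Qed.

Lemma tensor_outcome_cons m l s0 (b : m.-tuple 'I_3) (s : m.-tuple bool) i j x y :
  tensor_entry (outcome_proj (cons_tuple l b) (cons_tuple s0 s))
    (cons_tuple i x) (cons_tuple j y) =
  proj (pauli_ket R l s0) i j * tensor_entry (outcome_proj b s) x y.
Proof.
rewrite tensor_entry_cons /outcome_proj !tnth0; congr (_ * _).
by apply: eq_bigr => a _; rewrite !tnthS.
Qed.

Lemma tensor_shadow_cons m l s0 (b : m.-tuple 'I_3) (s : m.-tuple bool) i j x y :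
  tensor_entry (shadow1 (cons_tuple l b) (cons_tuple s0 s))
    (cons_tuple i x) (cons_tuple j y) =
  (3 *: proj (pauli_ket R l s0) - 1%:M) i j * tensor_entry (shadow1 b s) x y.
Proof.
rewrite tensor_entry_cons /shadow1 /outcome_proj !tnth0; congr (_ * _).
by apply: eq_bigr => a _; rewrite !tnthS.
Qed.

Lemma tuple_pairing_cons m (F G : m.+1.-tuple 'I_2 -> m.+1.-tuple 'I_2 -> C) :
  \sum_x \sum_y F x y * G x y =
  \sum_(x : m.-tuple 'I_2) \sum_(y : m.-tuple 'I_2) \sum_i \sum_j
    F (cons_tuple i x) (cons_tuple j y) * G (cons_tuple i x) (cons_tuple j y).
Proof.
rewrite big_tuple_cons.
under eq_bigr => i _ do (under eq_bigr => x _ do rewrite big_tuple_cons).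
by rewrite exchange_sum4.
Qed.

(** Induction on the qubits. For a fixed setting and outcome on the first one, the hypothesis bounds
    the sum over the others; the one-qubit bound then applies to each 2 x 2 block of [X]. Each qubit
    costs 12/7 times 3, since the settings are summed and not averaged. *)
Lemma second_moment m (sigma X : m.-tuple 'I_2 -> m.-tuple 'I_2 -> C) :
  psdf sigma ->
  \sum_(b : m.-tuple 'I_3) \sum_(s : m.-tuple bool)
    complex.Re (\sum_x \sum_y sigma x y * tensor_entry (outcome_proj b s) y x)
    * normsq (\sum_x \sum_y tensor_entry (shadow1 b s) x y * X y x)
  <= (3 * (12 / 7)) ^+ m * complex.Re (\sum_x sigma x x)
     * \sum_x \sum_y normsq (X x y).
Proof.
elim: m sigma X => [|m IH] sigma X hs.
  by rewrite !big_tuple_nil /tensor_entry !big_ord0 mulr1 mul1r expr0 mul1r.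
(* [sg] is the state of the tail after the first outcome, [Xs] is [X] contracted with the first
   shadow factor, [tau] is the reduced state of the first qubit. *)
pose sg l s0 (x y : m.-tuple 'I_2) :=
  \sum_i \sum_j sigma (cons_tuple i x) (cons_tuple j y) * proj (pauli_ket R l s0) j i.
pose Xs l s0 (y x : m.-tuple 'I_2) :=
  \sum_i \sum_j (3 *: proj (pauli_ket R l s0) - 1%:M) i j *
    X (cons_tuple j y) (cons_tuple i x).
pose tau i j := \sum_(x : m.-tuple 'I_2) sigma (cons_tuple i x) (cons_tuple j x).
have tau_psd : psdf tau by apply: psdf_head.
have c0 : 0 <= (3 * (12 / 7) : R) ^+ m by rewrite exprn_ge0//; lra.
have [c cE] : exists c : R, c = 3 * (12 / 7) by exists (3 * (12 / 7)).
rewrite -!cE in c0 IH *.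
apply: (@le_trans _ _ (\sum_l \sum_s0 c ^+ m * complex.Re (\sum_x sg l s0 x x)
     * \sum_x \sum_y normsq (Xs l s0 x y))).
  rewrite big_tuple_cons; apply: ler_sum => l _.
  under eq_bigr => b _ do rewrite big_tuple_cons.
  rewrite exchange_big; apply: ler_sum => s0 _.
  apply: (le_trans _ (IH (sg l s0) (Xs l s0) (psdf_tail hs _))).
  apply: ler_sum => b _; apply: ler_sum => s _.
  rewrite !tuple_pairing_cons.
  rewrite le_eqVlt; apply/orP; left; apply/eqP.
  congr (complex.Re _ * normsq _); apply: eq_bigr => x _; apply: eq_bigr => y _.
    rewrite mulr_suml; apply: eq_bigr => i _.
    rewrite mulr_suml; apply: eq_bigr => j _.
    by rewrite tensor_outcome_cons mulrA.
  rewrite mulr_sumr; apply: eq_bigr => i _.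
  rewrite mulr_sumr; apply: eq_bigr => j _.
  by rewrite tensor_shadow_cons mulrAC mulrC.
(* The trace left by the induction hypothesis is the Born weight of the first outcome in [tau], the
   weight that the one-qubit bound expects. *)
have htr l s0 : \sum_x sg l s0 x x =
    \sum_i \sum_j tau i j * proj (pauli_ket R l s0) j i.
  rewrite exchange_big; apply: eq_bigr => i _ /=.
  rewrite exchange_big; apply: eq_bigr => j _ /=.
  by rewrite mulr_suml.
rewrite [leLHS](_ : _ = c ^+ m * \sum_(x : m.-tuple 'I_2) \sum_(y : m.-tuple 'I_2)
    \sum_l \sum_s0 complex.Re (\sum_i \sum_j tau i j * proj (pauli_ket R l s0) j i)
       * normsq (Xs l s0 x y)); last first.
  rewrite exchange_sum22 mulr_sumr; apply: eq_bigr => l _.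
  rewrite mulr_sumr; apply: eq_bigr => s0 _.
  rewrite htr -mulrA mulr_sumr; congr (_ * _); apply: eq_bigr => x _.
  by rewrite mulr_sumr.
rewrite exprS [c * _]mulrC -(mulrA (c ^+ m)) -(mulrA (c ^+ m)) ler_wpM2l//.
rewrite [leRHS](_ : _ = \sum_(x : m.-tuple 'I_2) \sum_(y : m.-tuple 'I_2)
  c * complex.Re (tau 0 0 + tau 1 1) * \sum_i \sum_j
     normsq (X (cons_tuple i x) (cons_tuple j y))).
  apply: ler_sum => x _; apply: ler_sum => y _.
  rewrite cE; exact: (second_moment1 (fun i j => X (cons_tuple i x) (cons_tuple j y)) tau_psd).
under [RHS]eq_bigr => x _ do rewrite -mulr_sumr.
rewrite -[RHS]mulr_sumr -exchange_sum4; congr (_ * _).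
  congr (c * complex.Re _).
  rewrite big_tuple_cons !big_ord_recl big_ord0 addr0.
  by rewrite (_ : lift ord0 ord0 = 1) //; exact: val_inj.
rewrite big_tuple_cons; apply: eq_bigr => i _; apply: eq_bigr => x _.
by rewrite big_tuple_cons.
Qed.

End Shadows.

Lemma prod_eq_tuple (S : comPzRingType) (T : eqType) m (x y : m.-tuple T) :
  \prod_(a < m) (tnth x a == tnth y a)%:R = (x == y)%:R :> S.
Proof.
have [->|/eqP xy] := eqVneq x y.
  by apply: big1 => a _; rewrite eqxx.
have [a xya] : exists a, tnth x a != tnth y a.
  apply/existsP; rewrite -negb_forall; apply/negP => /forallP h.
  by apply/xy/eq_from_tnth => a; apply/eqP.
by rewrite (bigD1 a) //= (negbTE xya) mul0r.
Qed.

(** * Completeness of the outcomes and unbiasedness of the shadow *)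

Section Matrices.
Variables (R : realType) (m : nat).
Local Notation C := R[i].
Implicit Types (b : m.-tuple 'I_3) (s : m.-tuple bool).
Local Notation outcome b s := (proj (pauli_product_ket R b s)).
Local Notation zeta b s := (classical_shadow R b s).

Lemma proj_product_ketE b s x y :
  outcome b s x y = tensor_entry (outcome_proj R b s) (enum_val x) (enum_val y).
Proof.
rewrite mxE big_ord1 !mxE rmorph_prod -big_split /=; apply: eq_bigr => a _.
by rewrite /outcome_proj [RHS]mxE big_ord1 !mxE.
Qed.

Lemma classical_shadowE b s x y :
  zeta b s x y = tensor_entry (shadow1 R b s) (enum_val x) (enum_val y).
Proof. by rewrite mxE. Qed.

Lemma one_tensor_entry (x y : 'I_(qdim m)) :
  (1%:M : qop R m) x y = \prod_a (1%:M : 'M[C]_2) (tnth (enum_val x) a) (tnth (enum_val y) a).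
Proof.
rewrite mxE -(inj_eq enum_val_inj) -prod_eq_tuple.
by apply: eq_bigr => a _; rewrite mxE.
Qed.

Lemma sum_outcome b : \sum_s outcome b s = 1%:M.
Proof.
apply/matrixP => x y; rewrite one_tensor_entry summxE.
rewrite (eq_bigr _ (fun s _ => proj_product_ketE b s x y)).
rewrite (sum_tuple_prod (fun a t => proj (pauli_ket R (tnth b a) t)
  (tnth (enum_val x) a) (tnth (enum_val y) a))).
by apply: eq_bigr => a _; rewrite -(sum_proj_pauli_ket R (tnth b a)) summxE.
Qed.

Lemma sum_outcome_shadow (x y u v : m.-tuple 'I_2) :
  \sum_b \sum_s tensor_entry (outcome_proj R b s) x y * tensor_entry (shadow1 R b s) u v
  = 3 ^+ m * ((x == v)%:R * (y == u)%:R).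
Proof.
under eq_bigr => b _.
  under eq_bigr => s _ do rewrite /tensor_entry -big_split /=.
  rewrite (sum_tuple_prod (fun a t =>
     proj (pauli_ket R (tnth b a) t) (tnth x a) (tnth y a) *
     (3 *: proj (pauli_ket R (tnth b a) t) - 1%:M) (tnth u a) (tnth v a))).
  over.
rewrite (sum_tuple_prod (fun a l => \sum_t
     proj (pauli_ket R l t) (tnth x a) (tnth y a) *
     (3 *: proj (pauli_ket R l t) - 1%:M) (tnth u a) (tnth v a))).
under eq_bigr => a _ do rewrite sum_shadow_swap.
by rewrite big_split /= prodr_const card_ord big_split /= !prod_eq_tuple.
Qed.

Lemma mxtrace_mulE d (A B : 'M[C]_d) :
  \tr (A *m B) = \sum_x \sum_y A x y * B y x.
Proof. by apply: eq_bigr => x _; rewrite mxE. Qed.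

Lemma mxtrace_tuple (A B : qop R m) :
  \tr (A *m B) = \sum_x \sum_y A (enum_rank x) (enum_rank y) * B (enum_rank y) (enum_rank x).
Proof.
rewrite mxtrace_mulE (reindex_onto enum_rank enum_val) /=; last by move=> *; rewrite enum_valK.
apply: eq_big => [x|x _]; first by rewrite enum_rankK eqxx.
rewrite (reindex_onto enum_rank enum_val) /=; last by move=> *; rewrite enum_valK.
by apply: eq_bigl => y; rewrite enum_rankK eqxx.
Qed.

(** Expanding both traces in entries leaves the sum of projector (x) shadow, which is 3^m times the
    swap of two m-qubit registers; the swap contracts A with X. *)
Lemma classical_shadow_unbiased (A X : qop R m) :
  \sum_b \sum_s \tr (A *m outcome b s) * \tr (zeta b s *m X) =
  3 ^+ m * \tr (A *m X).
Proof.
rewrite [in RHS]mxtrace_tuple.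
transitivity (\sum_x \sum_y \sum_u \sum_v
  (A (enum_rank x) (enum_rank y) * X (enum_rank v) (enum_rank u)) *
  (\sum_b \sum_s tensor_entry (outcome_proj R b s) y x * tensor_entry (shadow1 R b s) u v)).
  under [RHS]eq_bigr => x _.
    under eq_bigr => y _.
      under eq_bigr => u _.
        under eq_bigr => v _.
          rewrite mulr_sumr.
          under eq_bigr => b _ do rewrite mulr_sumr.
          over.
        over.
      rewrite exchange_sum22; over.
    over.
  rewrite exchange_sum22; apply: eq_bigr => b _; apply: eq_bigr => s _ /=.
  rewrite !mxtrace_tuple mulr_suml; apply: eq_bigr => x _.
  rewrite mulr_suml; apply: eq_bigr => y _.
  rewrite mulr_sumr; apply: eq_bigr => u _.
  rewrite mulr_sumr; apply: eq_bigr => v _.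
  rewrite proj_product_ketE classical_shadowE !enum_rankK.
  by rewrite -!mulrA; congr (_ * _); rewrite mulrC -!mulrA mulrC mulrA.
rewrite mulr_sumr; apply: eq_bigr => x _; rewrite mulr_sumr; apply: eq_bigr => y _.
rewrite (bigD1 x) //= [X in _ + X]big1 ?addr0; last first.
  move=> u ux; apply: big1 => v _.
  by rewrite sum_outcome_shadow [x == u]eq_sym (negbTE ux) !mulr0.
rewrite (bigD1 y) //= [X in _ + X]big1 ?addr0; last first.
  by move=> v vy; rewrite sum_outcome_shadow [y == v]eq_sym (negbTE vy) mul0r !mulr0.
by rewrite sum_outcome_shadow !eqxx !mulr1 mulrC.
Qed.

End Matrices.

(** * Mean, second moment and range of the overlap *)

Section OutcomeStatistics.
Variables (R : realType).
Local Notation C := R[i].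
Local Notation Re := complex.Re.

Lemma ReN (z : C) : Re (- z) = - Re z.
Proof. by case: z. Qed.

Lemma ReB (x y : C) : Re (x - y) = Re x - Re y.
Proof. by rewrite ReD ReN. Qed.

Lemma ReZ (a : R) (z : C) : Re (a%:C%C * z) = a * Re z.
Proof. by case: z => x y /=; rewrite mul0r subr0. Qed.

Lemma ge0_ReM (x y : C) : 0 <= x -> Re (x * y) = Re x * Re y.
Proof.
case: x y => x x' [y y']; rewrite lecE /= => /andP[/eqP-> _].
by rewrite mul0r subr0.
Qed.

Lemma trace_proj_ge0 d (A : 'M[C]_d) (v : 'cV_d) : psd A -> 0 <= \tr (A *m proj v).
Proof. by move=> hA; rewrite mxtrace_proj. Qed.

Variable m : nat.
Implicit Types (b : m.-tuple 'I_3) (s : m.-tuple bool) (sigma : qop R m) (phi : ket R m).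
Local Notation outcome b s := (proj (pauli_product_ket R b s)).
Local Notation zeta b s := (classical_shadow R b s).

Definition outcome_weight sigma b s : R := Re (\tr (sigma *m outcome b s)).
Definition overlap phi b s : R := Re (\tr (zeta b s *m proj phi)).

Lemma outcome_weight_ge0 sigma b s : psd sigma -> 0 <= outcome_weight sigma b s.
Proof. by move=> h; apply/ge0_Re/trace_proj_ge0. Qed.

Lemma sum_outcome_weight sigma b : \sum_s outcome_weight sigma b s = Re (\tr sigma).
Proof. by rewrite -ReX -raddf_sum -mulmx_sumr sum_outcome mulmx1. Qed.

Lemma sum_weight_overlap sigma phi : psd sigma ->
  \sum_b \sum_s outcome_weight sigma b s * overlap phi b s =
  3 ^+ m * Re (\tr (sigma *m proj phi)).
Proof.
move=> h.
have -> : 3 ^+ m * Re (\tr (sigma *m proj phi)) = Re (3 ^+ m * \tr (sigma *m proj phi)).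
  by rewrite -ReZ rmorphXn rmorph_nat.
rewrite -classical_shadow_unbiased ReX; apply: eq_bigr => b _.
rewrite ReX; apply: eq_bigr => s _.
by rewrite ge0_ReM ?trace_proj_ge0.
Qed.

Lemma normsqM (x y : C) : normsq (x * y) = normsq x * normsq y.
Proof. by case: x => a b; case: y => c d; rewrite /normsq /=; ring. Qed.

Lemma normsq_conj (x : C) : normsq x^* = normsq x.
Proof. by case: x => a b; rewrite /normsq /= sqrrN. Qed.

Lemma Re_trace_proj d (v : 'cV[C]_d) : Re (\tr (proj v)) = \sum_x normsq (v x 0).
Proof.
rewrite ReX; apply: eq_bigr => x _; rewrite mxE big_ord1 !mxE.
by case: (v x 0) => a b; rewrite /normsq /= mulrN opprK !expr2.
Qed.

Lemma frobenius_proj d (v : 'cV[C]_d) :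
  \sum_x \sum_y normsq (proj v x y) = Re (\tr (proj v)) ^+ 2.
Proof.
rewrite Re_trace_proj expr2 mulr_suml; apply: eq_bigr => x _.
rewrite mulr_sumr; apply: eq_bigr => y _.
by rewrite mxE big_ord1 !mxE normsqM normsq_conj.
Qed.

Lemma sum_ord_tuple (V : nmodType) (F : 'I_(qdim m) -> V) :
  \sum_x F x = \sum_(x : m.-tuple 'I_2) F (enum_rank x).
Proof.
rewrite (reindex_onto enum_rank enum_val) /=; last by move=> *; rewrite enum_valK.
by apply: eq_bigl => x; rewrite enum_rankK eqxx.
Qed.

(** The squared Frobenius norm of [proj phi] is the square of its trace, hence at most 1, and the
    squared real part is at most the squared modulus. *)
Lemma sum_weight_overlap_sqr sigma phi : psd sigma -> Re (\tr (proj phi)) <= 1 ->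
  \sum_b \sum_s outcome_weight sigma b s * overlap phi b s ^+ 2 <=
  3 ^+ m * (12 / 7) ^+ m * Re (\tr sigma).
Proof.
move=> h h1.
have tr0 : 0 <= Re (\tr (proj phi)).
  by rewrite Re_trace_proj; apply: sumr_ge0 => x _; rewrite addr_ge0 ?sqr_ge0.
have trs0 : 0 <= Re (\tr sigma).
  rewrite -(sum_outcome_weight sigma [tuple ord0 | i < m]).
  by apply: sumr_ge0 => s _; apply: outcome_weight_ge0.
pose f (A : qop R m) (x y : m.-tuple 'I_2) := A (enum_rank x) (enum_rank y).
have fpsd : psdf (f sigma).
  move=> v; have := h (\col_x v (enum_val x)).
  rewrite mxE sum_ord_tuple; congr (_ <= _).
  under eq_bigr => y _ do rewrite mxE sum_ord_tuple mulr_suml.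
  rewrite exchange_big; apply: eq_bigr => x _; apply: eq_bigr => y _.
  by rewrite !mxE !enum_rankK.
have := second_moment (f (proj phi)) fpsd.
have -> : \sum_x f sigma x x = \tr sigma by rewrite [RHS]sum_ord_tuple.
have -> : \sum_x \sum_y normsq (f (proj phi) x y) = Re (\tr (proj phi)) ^+ 2.
  rewrite -frobenius_proj [RHS]sum_ord_tuple.
  by apply: eq_bigr => x _; rewrite [RHS]sum_ord_tuple.
move=> H; apply: le_trans (le_trans _ H) _; last first.
  rewrite exprMn ler_piMr ?exprn_ile1//.
  by rewrite !mulr_ge0 ?exprn_ge0//; lra.
apply: ler_sum => b _; apply: ler_sum => s _.
have <- : outcome_weight sigma b s =
    Re (\sum_x \sum_y f sigma x y * tensor_entry (outcome_proj R b s) y x).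
  rewrite /outcome_weight mxtrace_tuple; congr Re.
  apply: eq_bigr => x _; apply: eq_bigr => y _.
  by rewrite proj_product_ketE !enum_rankK.
rewrite ler_wpM2l ?outcome_weight_ge0//.
have <- : \tr (zeta b s *m proj phi) =
    \sum_x \sum_y tensor_entry (shadow1 R b s) x y * f (proj phi) y x.
  rewrite mxtrace_tuple.
  apply: eq_bigr => x _; apply: eq_bigr => y _.
  by rewrite classical_shadowE !enum_rankK.
by rewrite /normsq lerDl sqr_ge0.
Qed.

Lemma sum_fidelity phi b :
  \sum_s outcome_weight (proj phi) b s = Re (\tr (proj phi)).
Proof. exact: sum_outcome_weight. Qed.

(** Each factor 3 P_s - 1 equals 2 P_s minus the opposite projector, so the shadow is diagonal in
    the measured product basis. *)
Lemma classical_shadow_expand b s :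
  zeta b s = \sum_t (\prod_a (if tnth t a == tnth s a then 2 else -1))%:C%C *: outcome b t.
Proof.
apply/matrixP => x y; rewrite summxE.
rewrite (eq_bigr (fun t : m.-tuple bool => \prod_a
  ((if tnth t a == tnth s a then 2 else -1)%:C%C *
   proj (pauli_ket R (tnth b a) (tnth t a)) (tnth (enum_val x) a) (tnth (enum_val y) a))));
  last first.
  move=> t _; rewrite mxE proj_product_ketE rmorph_prod /tensor_entry -big_split /=.
  by [].
rewrite (sum_tuple_prod (fun a t => (if t == tnth s a then 2 else -1)%:C%C *
   proj (pauli_ket R (tnth b a) t) (tnth (enum_val x) a) (tnth (enum_val y) a))).
rewrite classical_shadowE; apply: eq_bigr => a _.
rewrite /shadow1 -(sum_proj_pauli_ket R (tnth b a)) /outcome_proj !big_bool /=.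
have e2 : 2%:C%C = 2 :> C by rewrite rmorph_nat.
have e1 : (-1)%:C%C = -1 :> C by rewrite rmorphN1.
case: (tnth s a) => /=; rewrite e1 e2;
  move: (proj (pauli_ket R (tnth b a) true)) (proj (pauli_ket R (tnth b a) false)) => P Q;
  rewrite [LHS]mxE [X in X + _ = _]mxE [X in _ + X = _]mxE [X in _ - X = _]mxE;
  move: (P _ _) (Q _ _) => c d; ring.
Qed.

(** The eigenvalues of the shadow are at most 2^m in modulus, and the overlap is their sum weighted
    by the outcome weights of [phi], whose total is the trace of [proj phi]. *)
Lemma overlap_norm phi b s :
  `|overlap phi b s| <= 2 ^+ m * Re (\tr (proj phi)).
Proof.
rewrite -(sum_fidelity phi b) mulr_sumr /overlap classical_shadow_expand.
rewrite mulmx_suml [\tr _]raddf_sum ReX.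
apply: le_trans (ler_norm_sum _ _ _) _; apply: ler_sum => t _.
rewrite /= -scalemxAl mxtraceZ ReZ normrM mxtrace_mulC.
rewrite [`|Re _|]ger0_norm; last exact: outcome_weight_ge0 (psd_proj _).
rewrite ler_wpM2r ?outcome_weight_ge0 //; first exact: psd_proj.
rewrite normr_prod -[in leRHS](card_ord m) -prodr_const; apply: ler_prod => a _.
rewrite normr_ge0 /=; case: ifP => _; first by rewrite ger0_norm.
by rewrite normrN1 ler1n.
Qed.

End OutcomeStatistics.

(** * Sharp bounds for a single shadowed qubit *)

Section OneQubit.
Variables (R : realType).
Local Notation C := R[i].
Local Notation Re := complex.Re.
Implicit Types (b : 1.-tuple 'I_3) (s : 1.-tuple bool) (sigma : qop R 1) (phi : ket R 1).

Lemma classical_shadow1 b s :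
  classical_shadow R b s = 3 *: proj (pauli_product_ket R b s) - 1%:M.
Proof.
apply/matrixP => x y; rewrite classical_shadowE [RHS]mxE [X in X + _]mxE [X in _ + X]mxE.
rewrite proj_product_ketE one_tensor_entry /tensor_entry !big_ord1.
by rewrite /shadow1 [LHS]mxE [X in X + _]mxE [X in _ + X]mxE.
Qed.

Lemma overlap1 phi b s :
  overlap phi b s = 3 * outcome_weight (proj phi) b s - Re (\tr (proj phi)).
Proof.
rewrite /overlap classical_shadow1 mulmxBl mul1mx linearB /= -scalemxAl mxtraceZ ReB.
rewrite (_ : (3 : C) = 3%:C%C); last by rewrite rmorph_nat.
by rewrite ReZ mxtrace_mulC.
Qed.

Lemma overlap1_centered_norm phi b s :
  Re (\tr (proj phi)) = 0 \/ Re (\tr (proj phi)) = 1 ->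
  `|overlap phi b s - 2^-1| <= 3 / 2.
Proof.
have w0 s' := @outcome_weight_ge0 R _ _ b s' (psd_proj phi).
move=> h; have : outcome_weight (proj phi) b s <= Re (\tr (proj phi)).
  rewrite -(sum_outcome_weight (proj phi) b) (bigD1 s) //= lerDl.
  exact: sumr_ge0.
rewrite overlap1 ler_norml; move: (w0 s); case: h => -> => *; apply/andP; split; lra.
Qed.

(** For a unit [phi] the two outcomes of a setting give overlaps summing to 1, hence equally far
    from 1/2. The square thus does not depend on the outcome, [sigma] enters only through its trace,
    and the sum over settings is fixed by the purity of [phi]. *)
Lemma sum_weight_overlap1_sqr sigma phi : psd sigma ->
  Re (\tr (proj phi)) = 0 \/ Re (\tr (proj phi)) = 1 ->
  \sum_b \sum_s outcome_weight sigma b s * (overlap phi b s - 2^-1) ^+ 2 <=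
  9 / 4 * Re (\tr sigma).
Proof.
move=> hs h.
have trs0 : 0 <= Re (\tr sigma).
  rewrite -(sum_outcome_weight sigma [tuple ord0 | i < 1]).
  by apply: sumr_ge0 => s _; apply: outcome_weight_ge0.
case: h => [h0|h1].
  have o0 b s : overlap phi b s = 0.
    have := overlap_norm phi b s; rewrite h0 mulr0 => h.
    by apply/normr0_eq0/eqP; rewrite eq_le h normr_ge0.
  under eq_bigr => b _ do (under eq_bigr => s _ do rewrite o0).
  under eq_bigr => b _ do rewrite -mulr_suml sum_outcome_weight.
  move: (Re (\tr sigma)) trs0 => T T0.
  rewrite sumr_const card_tuple card_ord sub0r sqrrN -mulr_natl; lra.
pose w l t := outcome_weight sigma (cons_tuple l [tuple]) (cons_tuple t [tuple]).
pose o l t := overlap phi (cons_tuple l [tuple]) (cons_tuple t [tuple]).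
pose q l t := outcome_weight (proj phi) (cons_tuple l [tuple]) (cons_tuple t [tuple]).
have sum1 (f : 1.-tuple 'I_3 -> 1.-tuple bool -> R) : \sum_b \sum_s f b s =
    \sum_l (f (cons_tuple l [tuple]) (cons_tuple true [tuple])
          + f (cons_tuple l [tuple]) (cons_tuple false [tuple])).
  rewrite big_tuple_cons; apply: eq_bigr => l _; rewrite big_tuple_nil.
  by rewrite big_tuple_cons big_bool !big_tuple_nil.
have hw l : w l true + w l false = Re (\tr sigma).
  rewrite -(sum_outcome_weight sigma (cons_tuple l [tuple])).
  by rewrite big_tuple_cons big_bool !big_tuple_nil.
have hq l : q l true + q l false = 1.
  rewrite -h1 -(sum_outcome_weight (proj phi) (cons_tuple l [tuple])).
  by rewrite big_tuple_cons big_bool !big_tuple_nil.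
have ho l t : o l t = 3 * q l t - 1 by rewrite /o overlap1 h1.
(* Unbiasedness with [phi] itself as the measured state: three times the purity, which is 1. *)
have hqo : \sum_l (q l true * o l true + q l false * o l false) = 3.
  have := sum_weight_overlap phi (psd_proj phi); rewrite sum1 => ->.
  rewrite expr1 -[RHS]mulr1; congr (_ * _).
  rewrite -(expr1n _ 2) -h1 -frobenius_proj mxtrace_mulE ReX.
  apply: eq_bigr => x _; rewrite ReX; apply: eq_bigr => y _.
  rewrite -[in proj phi y x](proj_herm phi) !mxE.
  by case: (\sum_j _) => c d; rewrite /normsq /= mulrN opprK !expr2.
rewrite sum1.
have hl l : w l true * (o l true - 2^-1) ^+ 2 + w l false * (o l false - 2^-1) ^+ 2 =
  Re (\tr sigma) * (3 / 2 * (q l true * o l true + q l false * o l false) - 3 / 4).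
  rewrite -(hw l) !ho.
  have -> : q l false = 1 - q l true by rewrite -(hq l) addrC addKr.
  by field.
rewrite (eq_bigr _ (fun l _ => hl l)) -mulr_sumr sumrB -mulr_sumr hqo.
move: (Re (\tr sigma)) trs0 => T T0.
rewrite sumr_const card_ord -mulr_natl; lra.
Qed.

End OneQubit.

(** * Spectral gap *)

Lemma char_poly_conj (F : fieldType) n (P A : 'M[F]_n) :
  P \in unitmx -> char_poly (invmx P *m A *m P) = char_poly A.
Proof.
move=> uP; pose f : 'M[F]_n -> 'M[{poly F}]_n := map_mx polyC.
have fM (B D : 'M[F]_n) : f (B *m D) = f B *m f D by rewrite /f map_mxM.
have fP : f (invmx P) *m f P = 1%:M by rewrite -fM mulVmx ///f map_mx1.
have -> : char_poly (invmx P *m A *m P) =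
    \det (f (invmx P) *m char_poly_mx A *m f P).
  rewrite /char_poly /char_poly_mx -/(f _) -/(f A) !fM; congr (\det _).
  by rewrite mulmxBr mulmxBl scalar_mxC -(mulmxA _%:M) fP mulmx1.
by rewrite !det_mulmx mulrAC -det_mulmx fP det1 mul1r.
Qed.

(** In the decreasing order only the entry at index 0 can exceed the one at index 1. This is what
    makes an eigenvalue above [lambda2] simple. *)
Lemma count_gt_second (R : realDomainType) (t : seq R) :
  (count (fun x => (nth 0 (sort >=%R t) 1 < x)%R) t <= 1)%N.
Proof.
have /permP <- : perm_eq (sort >=%R t) t by rewrite perm_sort.
have : sorted >=%R (sort >=%R t) by apply: sort_sorted => x y; exact: le_total.
case: (sort _ t) => [|a [|b u]] //=; first by rewrite addn0; case: (_ < _).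
move=> /andP[_]; rewrite path_sortedE; last by move=> x y z /= h1 h2; apply: le_trans h2 h1.
move=> /andP[/allP hu _]; rewrite ltxx add0n.
rewrite (@eq_in_count _ _ pred0) ?count_pred0 ?addn0; first by case: (_ < _).
by move=> x /hu /=; rewrite ltNge => ->.
Qed.

Section Gap.
Variables (R : realType) (d : nat).
Local Notation C := R[i].
Local Notation Re := complex.Re.
Variable A : 'M[C]_d.
Hypothesis Aherm : A^t* = A.

Lemma spectral_decomposition :
  A = (spectralmx A)^t* *m diag_mx (spectral_diag A) *m spectralmx A.
Proof.
have nA : A \is normalmx by apply/normalmxP; rewrite Aherm.
rewrite -invmx_unitary ?spectral_unitarymx//; exact/orthomx_spectralP.
Qed.

Lemma eigenvalues_spectral :
  perm_eq (eigenvalues A) [seq spectral_diag A 0 i | i <- enum 'I_d].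
Proof.
apply: prod_XsubC_eq.
rewrite /eigenvalues; case: closed_field_poly_normal => r /= hr.
move: hr; rewrite (monicP (char_poly_monic A)) scale1r => <-.
rewrite [in LHS]spectral_decomposition -invmx_unitary ?spectral_unitarymx//.
rewrite char_poly_conj ?spectral_unit// char_poly_trig ?diag_mx_is_trig//.
rewrite big_map big_enum /=; apply: eq_bigr => i _.
by rewrite mxE eqxx mulr1n.
Qed.

Let lam i := Re (spectral_diag A 0 i).

Lemma lambda2E : lambda2 A = nth 0 (sort >=%R [seq lam i | i <- enum 'I_d]) 1.
Proof.
rewrite /lambda2; congr (nth 0 _ 1); apply/perm_sortP.
- by move=> x y; exact: le_total.
- by move=> x y z /= h1 h2; apply: le_trans h2 h1.
- by move=> x y /= /andP[h1 h2]; apply/eqP; rewrite eq_le h1 h2.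
rewrite (_ : map lam _ = map (@Re R) [seq spectral_diag A 0 i | i <- enum 'I_d]).
  exact: perm_map eigenvalues_spectral.
exact: (map_comp (@Re R) (fun i => spectral_diag A 0 i)).
Qed.

Lemma lambda2_lt_unique i j : lambda2 A < lam i -> lambda2 A < lam j -> i = j.
Proof.
move=> hi hj.
have := count_gt_second [seq lam i | i <- enum 'I_d].
rewrite -lambda2E count_map -size_filter enumT.
rewrite (_ : size _ = #|[pred i | lambda2 A < lam i]|); last by rewrite cardE.
by move/card_le1_eqP; apply.
Qed.

Hypothesis Apsd : psd A.

Lemma psd_diag (B : 'M[C]_d) i : psd B -> 0 <= B i i.
Proof.
move=> /(_ (delta_mx i 0)).
rewrite -mulmxA -colE mxE (bigD1 i) //= big1 => [|k ki].
  by rewrite !mxE !eqxx conjC1 mul1r addr0.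
by rewrite !mxE (negbTE ki) /= conjC0 mul0r.
Qed.

Lemma spectral_diag_ge0 i : 0 <= spectral_diag A 0 i.
Proof.
have := psd_diag i (psd_conj (spectralmx A) Apsd).
rewrite {2}spectral_decomposition !mulmxA.
have /unitarymxP -> := spectral_unitarymx A.
rewrite mul1mx -mulmxA; have /unitarymxP -> := spectral_unitarymx A.
by rewrite mulmx1 mxE eqxx mulr1n.
Qed.

Lemma lambda2_ge0 : 0 <= lambda2 A.
Proof.
rewrite lambda2E; set t := [seq lam i | i <- enum 'I_d].
(* With fewer than two eigenvalues, [lambda2] is the default value 0. *)
have [h|h] := ltnP 1 (size (sort >=%R t)); last by rewrite nth_default.
have := mem_nth 0 h; rewrite mem_sort => /mapP[i _ ->].
by apply: ge0_Re; exact: spectral_diag_ge0.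
Qed.

(** In an eigenbasis of [A] the vector [v] sits on the single index [i0] with eigenvalue 1, so the
    fidelity is the diagonal entry of the rotated state there; the remaining mass meets eigenvalues
    at most [lambda2]. *)
Lemma trace_le_spectral_gap (v : 'cV[C]_d) (rho : 'M[C]_d) :
  is_pure_state v -> A *m v = v -> is_density rho -> 0 < spectral_gap A ->
  Re (\tr (rho *m A)) <= 1 - spectral_gap A * (1 - fidelity v rho).
Proof.
move=> hv Av [_ rpsd rtr] gap.
set U := spectralmx A; set D := spectral_diag A.
have UU : U *m U^t* = 1%:M by apply/unitarymxP/spectral_unitarymx.
have UU' : U^t* *m U = 1%:M by apply/mulmx1C.
have AE : A = U^t* *m diag_mx D *m U := spectral_decomposition.
pose c := U *m v; pose rho' := U *m rho *m U^t*.
have cE : v = U^t* *m c by rewrite /c mulmxA UU' mul1mx.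
have c1 : (c^t* *m c) 0 0 = 1.
  by rewrite /c adjmxM -mulmxA (mulmxA _ U) UU' mul1mx.
(* The fixed-point equation in eigencoordinates: [c] vanishes wherever the eigenvalue is not 1. *)
have Dc i : D 0 i * c i 0 = c i 0.
  have : diag_mx D *m c = c.
    have : U *m (A *m v) = U *m v by rewrite Av.
    by rewrite {1}AE !mulmxA UU mul1mx -mulmxA.
  by move=> /matrixP /(_ i 0); rewrite mul_diag_mx mxE.
clearbody c.
have [i0 ci0] : exists i, c i 0 != 0.
  apply/existsP; apply: contraT; rewrite negb_exists => /forallP h.
  move: c1; rewrite mxE big1 => [/eqP|i _]; first by rewrite eq_sym oner_eq0.
  by move: (h i); rewrite negbK => /eqP ->; rewrite mulr0.
have D1 i : c i 0 != 0 -> D 0 i = 1.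
  by move=> ci; apply: (mulIf ci); rewrite Dc mul1r.
have l1 : lambda2 A < 1 by move: gap; rewrite subr_gt0.
have li0 : lam i0 = 1 by rewrite /lam -/D D1.
have lle i : i != i0 -> lam i <= lambda2 A.
  move=> ii0; rewrite leNgt; apply: contra ii0 => h.
  by apply/eqP/lambda2_lt_unique; rewrite ?li0.
have c0 i : i != i0 -> c i 0 = 0.
  move=> /lle h; apply/eqP; apply: contraT => /D1 e.
  by move: (le_lt_trans h l1); rewrite /lam -/D e ltxx.
have rpsd' : psd rho' by apply: psd_conj.
have fid : fidelity v rho = Re (rho' i0 i0).
  rewrite /fidelity (_ : v^t* *m rho *m v = c^t* *m rho' *m c); last first.
    by rewrite [in LHS]cE adjmxM trmxCK /rho' !mulmxA.
  rewrite mxE (bigD1 i0) //= [X in _ + X]big1 => [|i /c0->]; last by rewrite mulr0.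
  rewrite mxE (bigD1 i0) //= [X in (_ + X) * _]big1 => [|i /c0 h]; last first.
    rewrite (_ : c^t* 0 i = 0) ?mul0r// mxE mxE h; exact: conjC0.
  rewrite !addr0 mulrAC; move: c1; rewrite mxE (bigD1 i0) //=.
  rewrite [X in _ + X]big1 => [|i /c0->]; last by rewrite mulr0.
  by rewrite addr0 => ->; rewrite mul1r.
have rtr' : \sum_i Re (rho' i i) = 1.
  by rewrite -ReX -[X in Re X]/(\tr rho') /rho' mxtrace_mulC mulmxA UU' mul1mx rtr.
have -> : Re (\tr (rho *m A)) = \sum_i Re (rho' i i) * lam i.
  rewrite AE !mulmxA mxtrace_mulC !mulmxA -/rho' ReX; apply: eq_bigr => i _.
  by rewrite mul_mx_diag mxE ge0_ReM ?psd_diag.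
have rest : \sum_(i | i != i0) Re (rho' i i) = 1 - Re (rho' i0 i0).
  by rewrite -rtr' [in RHS](bigD1 i0) //= addrAC subrr add0r.
have -> : 1 - spectral_gap A * (1 - fidelity v rho) =
    Re (rho' i0 i0) + (1 - Re (rho' i0 i0)) * lambda2 A.
  by rewrite fid /spectral_gap; ring.
rewrite (bigD1 i0) //= li0 mulr1 lerD2l -rest mulr_suml.
apply: ler_sum => i ii0; apply: ler_wpM2l; last exact: lle.
exact/ge0_Re/psd_diag.
Qed.

End Gap.

(** * Statistics of one run *)

Section Dpso.
Variables (R : realType) (n r : nat).
Local Notation C := R[i].
Local Notation Re := complex.Re.
Variables (psi : ket R n) (p : subsets n (n - r)%N -> R) (q : (n - r).-tuple 'I_3 -> R).
Hypothesis rn : (r <= n)%N.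
Hypotheses (hp : is_distribution p) (hq : is_distribution q).

Local Notation W J l z := (@slice R n (n - r)%N r (val (J : subsets n (n - r)%N))
  (@pauli_product_ket R (n - r)%N l z)).

Local Notation phi J l z := (@reduced_target R n r psi J l z).

(** If [v] is nonzero, [phi] is a unit vector along it. If [v] is zero, the convention 0^-1 = 0
    makes [phi] zero, and both sides of the second claim vanish. *)
Lemma normalize_cases d (v : 'cV[C]_d) (phi := ((l2norm v)^-1)%:C%C *: v) :
  (Re (\tr (proj phi)) = 0 \/ Re (\tr (proj phi)) = 1) /\ proj phi *m v = v.
Proof.
pose S := \sum_x normsq (v x 0).
have S0 : 0 <= S by apply: sumr_ge0 => x _; rewrite addr_ge0 ?sqr_ge0.
have vv : v^t* *m v = (S%:C%C)%:M.
  apply/matrixP => i j; rewrite !ord1 !mxE eqxx mulr1n rmorph_sum /=.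
  apply: eq_bigr => x _; rewrite !mxE; case: (v x 0) => a b.
  by apply/eqP; rewrite eq_complex /normsq /= -!expr2; apply/andP; split; apply/eqP; ring.
have lS : l2norm v ^+ 2 = S by rewrite /l2norm vv mxE eqxx mulr1n /= sqr_sqrtr.
have pE : proj phi = ((S^-1)%:C)%C *: proj v.
  rewrite /proj /phi -scalemxAl linearZ /= map_mxZ -scalemxAr scalerA; congr (_ *: _).
  rewrite -lS -exprVn expr2 rmorphM; congr (_ * _).
  by apply/eqP; rewrite eq_complex /= oppr0 !eqxx.
have trE : Re (\tr (proj phi)) = S^-1 * S.
  by rewrite pE mxtraceZ ReZ Re_trace_proj.
have pv : proj phi *m v = ((S^-1 * S)%:C)%C *: v.
  by rewrite pE -scalemxAl /proj -mulmxA vv mul_mx_scalar scalerA rmorphM.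
have [Sz|Sn] := eqVneq S 0; last first.
  by rewrite trE pv mulVf// scale1r; split; [right|].
rewrite trE Sz mulr0; split; first by left.
rewrite pv Sz mulr0 scale0r; apply/colP => x; rewrite mxE.
have /eqP := Sz; rewrite psumr_eq0 => [/allP /(_ x)|y _]; last by rewrite addr_ge0 ?sqr_ge0.
rewrite mem_index_enum => /(_ isT); case: (v x 0) => a b.
rewrite /normsq /= paddr_eq0 ?sqr_ge0// !sqrf_eq0 => /andP[/eqP-> /eqP->].
by [].
Qed.

Lemma reduced_target_cases J l z :
  Re (\tr (proj (phi J l z))) = 0 \/
  Re (\tr (proj (phi J l z))) = 1.
Proof.
by have [] := normalize_cases (partial_inner r (val J) (pauli_product_ket R l z) psi).
Qed.

Lemma proj_reduced_target J l z :
  proj (phi J l z) *m (W J l z *m psi) = W J l z *m psi.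
Proof.
rewrite -partial_innerE.
by have [] := normalize_cases (partial_inner r (val J) (pauli_product_ket R l z) psi).
Qed.

Lemma strategyE : strategy psi p q = \sum_J \sum_l \sum_z (p J * q l)%:C%C *:
  ((W J l z)^t* *m proj (phi J l z) *m W J l z).
Proof.
by do 3 (apply: eq_bigr => ? _); rewrite tensor_on_projE.
Qed.

Lemma sum_slice_outcomes (J : subsets n (n - r)%N) l :
  \sum_z (W J l z)^t* *m W J l z = 1%:M.
Proof.
have cJ : #|val J| = (n - r)%N by apply/eqP/(valP J).
apply: sum_slice => //; last exact: sum_outcome.
by rewrite cardsCs finset.setCK cJ card_ord subKn.
Qed.

Lemma sum_distributions (V : lmodType C) (v : V) :
  \sum_J \sum_l (p J * q l)%:C%C *: v = v.
Proof.
have [_ p1] := hp; have [_ q1] := hq.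
under eq_bigr => J _ do rewrite -scaler_suml -rmorph_sum -mulr_sumr q1 mulr1.
by rewrite -scaler_suml -rmorph_sum p1 scale1r.
Qed.

(** The reduced target projector fixes W psi for each outcome, so every fixed J and l contributes
    the sum of W^* W psi, which is [psi] by completeness. *)
Lemma strategy_target : strategy psi p q *m psi = psi.
Proof.
rewrite strategyE mulmx_suml -[RHS]sum_distributions; apply: eq_bigr => J _.
rewrite mulmx_suml; apply: eq_bigr => l _.
rewrite mulmx_suml -[in RHS](mul1mx psi) -(sum_slice_outcomes J l) mulmx_suml scaler_sumr.
apply: eq_bigr => z _.
rewrite -scalemxAl -(mulmxA _ _ psi) -(mulmxA _ (proj _)) proj_reduced_target.
by rewrite mulmxA.
Qed.

Lemma adjmx_sum (I : finType) d e (F : I -> 'M[C]_(d, e)) :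
  (\sum_i F i)^t* = \sum_i (F i)^t*.
Proof. by rewrite linear_sum raddf_sum. Qed.

Lemma strategy_herm : (strategy psi p q)^t* = strategy psi p q.
Proof.
rewrite strategyE; do 3 (rewrite adjmx_sum; apply: eq_bigr => ? _).
rewrite linearZ /= map_mxZ 2!adjmxM trmxCK proj_herm mulmxA; congr (_ *: _).
by apply/eqP; rewrite eq_complex /= oppr0 !eqxx.
Qed.

Lemma psd_sum (I : finType) d (F : I -> 'M[C]_d) :
  (forall i, psd (F i)) -> psd (\sum_i F i).
Proof.
move=> h v; rewrite mulmx_sumr mulmx_suml summxE.
by apply: sumr_ge0 => i _; apply: h.
Qed.

Lemma psdZ d (a : R) (A : 'M[C]_d) : 0 <= a -> psd A -> psd (a%:C%C *: A).
Proof.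
move=> a0 h v; rewrite -scalemxAr -scalemxAl mxE mulr_ge0//.
by rewrite lecE /= eqxx.
Qed.

Lemma strategy_psd : psd (strategy psi p q).
Proof.
rewrite strategyE; do 3 (apply: psd_sum => ?).
apply: psdZ; first by rewrite mulr_ge0 ?hp.1 ?hq.1.
by rewrite -{2}(trmxCK (W _ _ _)); apply: psd_conj; apply: psd_proj.
Qed.

Variable rho : qop R n.
Hypothesis hrho : is_density rho.

Local Notation sigma J l z := (W J l z *m rho *m (W J l z)^t*).
Local Notation om := (shadow_overlap psi).
Local Notation P := (run_prob p q rho).

Lemma sigma_psd J l z : psd (sigma J l z).
Proof. by apply: psd_conj; case: hrho. Qed.

Lemma big_run (F : run n r -> R) :
  \sum_w F w = \sum_J \sum_l \sum_z \sum_b \sum_s F (J, l, z, b, s).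
Proof.
rewrite !pair_bigA /=; apply: eq_bigr => w _.
by case: w => [[[[J l] z] b] s].
Qed.

Lemma run_probE J l z b s :
  P (J, l, z, b, s) = p J * q l * 3^-1 ^+ r * outcome_weight (sigma J l z) b s.
Proof.
congr (_ * _); rewrite /outcome_weight tensor_on_projE; congr Re.
by rewrite mulmxA mxtrace_mulC !mulmxA.
Qed.

Lemma run_prob_ge0 w : 0 <= P w.
Proof.
case: w => [[[[J l] z] b] s]; rewrite run_probE.
rewrite !mulr_ge0 ?hp.1 ?hq.1 ?exprn_ge0 ?invr_ge0 ?ler0n//.
by apply: outcome_weight_ge0; apply: sigma_psd.
Qed.

Lemma run_expectationE (f : run n r -> R) : \sum_w P w * f w =
  \sum_J \sum_l p J * q l * \sum_z 3^-1 ^+ r *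
    \sum_b \sum_s outcome_weight (sigma J l z) b s * f (J, l, z, b, s).
Proof.
rewrite big_run; apply: eq_bigr => J _; apply: eq_bigr => l _.
rewrite mulr_sumr; apply: eq_bigr => z _.
rewrite mulrA mulr_sumr; apply: eq_bigr => b _.
rewrite mulr_sumr; apply: eq_bigr => s _.
by rewrite run_probE mulrA.
Qed.

Lemma sum_trace_sigma J l : \sum_z Re (\tr (sigma J l z)) = 1.
Proof.
rewrite -ReX.
under eq_bigr => z _ do rewrite mxtrace_mulC mulmxA.
rewrite -raddf_sum -mulmx_suml sum_slice_outcomes mul1mx /=.
by case: hrho => _ _ ->.
Qed.

Lemma sum_distributionsR (a : R) : \sum_J \sum_l p J * q l * a = a.
Proof.
have [_ p1] := hp; have [_ q1] := hq.
under eq_bigr => J _ do rewrite -mulr_suml -mulr_sumr q1 mulr1.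
by rewrite -mulr_suml p1 mul1r.
Qed.

(** The bound is checked for each J, l, z with weight Tr sigma, the Born probability of z, and these
    sum to 1; 3^r cancels the uniform choice of settings on K. *)
Lemma run_expectation_le (f : run n r -> R) (V : R) :
  (forall J l z, \sum_b \sum_s outcome_weight (sigma J l z) b s * f (J, l, z, b, s)
     <= 3 ^+ r * V * Re (\tr (sigma J l z))) ->
  \sum_w P w * f w <= V.
Proof.
move=> h; rewrite run_expectationE -[leRHS]sum_distributionsR.
apply: ler_sum => J _; apply: ler_sum => l _; apply: ler_wpM2l.
  by rewrite mulr_ge0 ?hp.1 ?hq.1.
rewrite [leRHS](_ : _ = \sum_z V * Re (\tr (sigma J l z))); last first.
  by rewrite -mulr_sumr sum_trace_sigma mulr1.
apply: ler_sum => z _.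
rewrite exprVn ler_pdivrMl ?exprn_gt0 ?ltr0n// mulrA; exact: h.
Qed.

Lemma sum_run_prob : \sum_w P w = 1.
Proof.
have -> : \sum_w P w = \sum_w P w * 1 by apply: eq_bigr => w _; rewrite mulr1.
rewrite run_expectationE -[RHS]sum_distributionsR.
apply: eq_bigr => J _; apply: eq_bigr => l _; congr (_ * _).
rewrite -[RHS](sum_trace_sigma J l); apply: eq_bigr => z _.
under eq_bigr => b _.
  under eq_bigr => s _ do rewrite mulr1.
  rewrite sum_outcome_weight; over.
move: (Re _) => T.
rewrite sumr_const card_tuple card_ord -[X in _ * X]mulr_natl natrX mulrA exprVn.
by rewrite mulVf ?mul1r// expf_neq0// pnatr_eq0.
Qed.

(** Unbiasedness on K gives Tr(sigma phi) for each J, l, z; cycling the trace turns it into the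
    matching term of Tr(rho Omega). *)
Lemma mean_overlap : \sum_w P w * om w = Re (\tr (rho *m strategy psi p q)).
Proof.
rewrite run_expectationE strategyE mulmx_sumr [\tr _]raddf_sum ReX.
apply: eq_bigr => J _; rewrite /= mulmx_sumr [\tr _]raddf_sum ReX.
apply: eq_bigr => l _; rewrite /= mulmx_sumr [\tr _]raddf_sum ReX mulr_sumr.
apply: eq_bigr => z _ /=.
rewrite -scalemxAr mxtraceZ ReZ; congr (_ * _).
rewrite (sum_weight_overlap _ (@sigma_psd J l z)) mulrA exprVn mulVf ?mul1r; last first.
  by rewrite expf_neq0// pnatr_eq0.
by congr Re; move: (proj _) => B; rewrite !mulmxA [RHS]mxtrace_mulC !mulmxA.
Qed.

End Dpso.

(** * Error bounds *)

Lemma psd_trace_ge0 (R : realType) d (A : 'M[R[i]]_d) : psd A -> 0 <= complex.Re (\tr A).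
Proof.
by move=> h; rewrite ReX; apply: sumr_ge0 => i _; exact/ge0_Re/psd_diag.
Qed.

Section CenteredOverlap.
Variables (R : realType) (m : nat).
Local Notation Re := complex.Re.
Implicit Types (sigma : qop R m) (phi : ket R m).
Hypothesis m0 : (0 < m)%N.

(* Centring the overlap at 1/2 is needed only for one qubit, where the bounds
   below are tight. *)
Definition center : R := if m == 1%N then 2^-1 else 0.

Lemma centered_overlap_bound phi t b s :
  Re (\tr (proj phi)) = 0 \/ Re (\tr (proj phi)) = 1 -> 0 <= t <= 2^-1 ->
  t / 4 ^+ m.-1 * `|overlap phi b s - center| <= 3 / 4.
Proof.
move=> hphi /andP[t0 t1]; rewrite /center.
(* For m = 1 the bound is 1/2 times 3/2, with no room to spare; for m = k + 2 it is 1/2 times 2^m /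
   4^(m-1) = 2^(-k). *)
case: m m0 phi b s hphi => [|[|k]] //= _ phi b s hphi.
  rewrite expr0 divr1; apply: le_trans (ler_pM t0 _ t1 (overlap1_centered_norm b s hphi)) _.
    exact: normr_ge0.
  lra.
have h : `|overlap phi b s| <= 2 ^+ k.+2.
  apply: le_trans (overlap_norm _ _ _) _.
  by case: hphi => ->; rewrite ?mulr0 ?mulr1 ?exprn_ge0.
rewrite subr0 mulrAC ler_pdivrMr ?exprn_gt0//.
apply: le_trans (ler_pM t0 (normr_ge0 _) t1 h) _.
rewrite !exprS (_ : (4 : R) ^+ k = 2 ^+ k * 2 ^+ k); last by rewrite -exprMn -natrM.
have : 1 <= (2 : R) ^+ k by apply: exprn_ege1; rewrite ler1n.
by move: (2 ^+ k) => x x1; nra.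
Qed.

Lemma centered_second_moment sigma phi : psd sigma ->
  Re (\tr (proj phi)) = 0 \/ Re (\tr (proj phi)) = 1 ->
  \sum_b \sum_s outcome_weight sigma b s * (overlap phi b s - center) ^+ 2 <=
  3 ^+ m * (3 / 4 * 4 ^+ m.-1) * Re (\tr sigma).
Proof.
move=> hs hphi; have T0 := psd_trace_ge0 hs; rewrite /center.
case: m m0 sigma phi hs hphi T0 => [|[|k]] //= _ sigma phi hs hphi T0.
  apply: le_trans (sum_weight_overlap1_sqr hs hphi) _.
  move: (Re _) T0 => T T0; rewrite expr0 expr1; lra.
under eq_bigr => b _ do under eq_bigr => s _ do rewrite subr0.
have le1 : Re (\tr (proj phi)) <= 1 by case: hphi => ->; rewrite ?ler01.
apply: le_trans (sum_weight_overlap_sqr hs le1) _.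
rewrite ler_wpM2r// ler_wpM2l ?exprn_ge0//.
(* For m = k + 2 the claim (12/7)^m <= (3/4) 4^(m-1) starts from 144/49 <= 3, and each further qubit
   only compares 12/7 with 4. *)
have : (12 / 7 : R) ^+ k <= 4 ^+ k by apply: lerXn2r; rewrite ?nnegrE; lra.
have : 0 <= (12 / 7 : R) ^+ k by apply: exprn_ge0; lra.
rewrite !exprS; move: (_ ^+ k) (4 ^+ k) => x y; lra.
Qed.

End CenteredOverlap.

Section ErrorBounds.
Variables (R : realType) (n r : nat).
Local Notation Re := complex.Re.
Variables (psi : ket R n) (p : subsets n (n - r)%N -> R) (q : (n - r).-tuple 'I_3 -> R).
Variable rho : qop R n.
Hypotheses (r0 : (0 < r)%N) (rn : (r <= n)%N).
Hypotheses (hp : is_distribution p) (hq : is_distribution q) (hrho : is_density rho).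

Local Notation om := (@shadow_overlap R n r psi).
Local Notation P := (@run_prob R n r p q rho).
Local Notation center := (center R r).

Lemma centered_shadow_overlap_bound t w : 0 <= t <= 2^-1 ->
  t / 4 ^+ r.-1 * `|om w - center| <= 3 / 4.
Proof.
case: w => [[[[J l] z] b] s]; apply: centered_overlap_bound => //.
exact: reduced_target_cases.
Qed.

Lemma centered_shadow_overlap_variance :
  \sum_w P w * (om w - center) ^+ 2 <= 3 / 4 * 4 ^+ r.-1.
Proof.
apply: (run_expectation_le rn hp hq hrho) => J l z.
apply: centered_second_moment => //; first exact: sigma_psd.
exact: reduced_target_cases.
Qed.

Lemma mean_centered_overlap c :
  \sum_w P w * (om w - c) = Re (\tr (rho *m strategy psi p q)) - c.
Proof.
under eq_bigr => w _ do rewrite mulrBr.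
by rewrite sumrB -mulr_suml (sum_run_prob rn hp hq hrho) mul1r (mean_overlap psi _ _ hrho).
Qed.

(** The threshold 1 - t lies at least t above the mean, so acceptance is an upper deviation of t
    with variance proxy 4^(r-1). *)
Lemma accept_upper_tail N t : (0 < N)%N -> 0 <= t <= 2^-1 ->
  Re (\tr (rho *m strategy psi p q)) <= 1 - 2 * t ->
  \sum_(w : N.-tuple (run n r) | 1 - t <= N%:R^-1 * \sum_(i < N) om (tnth w i))
     runs_prob p q rho w <= expR (- (N%:R * (t ^+ 2 / (2 * 4 ^+ r.-1)))).
Proof.
move=> N0 ht hm.
apply: (@subgaussian_tail R _ P (run_prob_ge0 hp hq hrho) N (1 - t - center) t (4 ^+ r.-1)
   (fun w => om w - center)).
- exact: (sum_run_prob rn hp hq hrho).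
- by case/andP: ht.
- by rewrite exprn_gt0.
- by move=> w; apply: centered_shadow_overlap_bound.
- exact: centered_shadow_overlap_variance.
- rewrite mean_centered_overlap; lra.
- move=> w; rewrite sumrB sumr_const card_ord -[center *+ N]mulr_natl mulrBr lerD2r.
  by rewrite ler_pdivlMl ?ltr0n.
Qed.

(** The mean is now 1, at distance t above the threshold; the same upper-tail bound is applied to
    the negated centred overlap. *)
Lemma reject_lower_tail N t : (0 < N)%N -> 0 <= t <= 2^-1 ->
  Re (\tr (rho *m strategy psi p q)) = 1 ->
  \sum_(w : N.-tuple (run n r) | ~~ (1 - t <= N%:R^-1 * \sum_(i < N) om (tnth w i)))
     runs_prob p q rho w <= expR (- (N%:R * (t ^+ 2 / (2 * 4 ^+ r.-1)))).
Proof.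
move=> N0 ht hm.
apply: (@subgaussian_tail R _ P (run_prob_ge0 hp hq hrho) N (center - (1 - t)) t (4 ^+ r.-1)
   (fun w => - (om w - center))).
- exact: (sum_run_prob rn hp hq hrho).
- by case/andP: ht.
- by rewrite exprn_gt0.
- by move=> w; rewrite normrN; apply: centered_shadow_overlap_bound.
- by under eq_bigr => w _ do rewrite sqrrN; exact: centered_shadow_overlap_variance.
- under eq_bigr => w _ do rewrite mulrN.
  rewrite sumrN mean_centered_overlap hm; lra.
- move=> w; rewrite -ltNge ltr_pdivrMl ?ltr0n// => /ltW h.
  rewrite sumrN sumrB sumr_const card_ord -[center *+ N]mulr_natl [in leRHS]opprB mulrBr.
  by rewrite lerD2l lerN2.
Qed.

End ErrorBounds.

Theorem mainTheorem2 (R : realType) (n r : nat) (psi : ket R n) (rho : qop R n)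
    (p : subsets n (n - r)%N -> R) (q : (n - r).-tuple 'I_3 -> R)
    (eps delta : R) (N : nat) :
  (1 <= r <= n - 1)%N ->
  is_pure_state psi ->
  is_density rho ->
  is_distribution p ->
  is_distribution q ->
  0 < eps < 1 ->
  0 < delta < 1 ->
  let nu := spectral_gap (strategy psi p q) in
  0 < nu ->
  N = `|Num.ceil (2 ^+ (2 * r + 1) * (ln delta^-1 / (nu ^+ 2 * eps ^+ 2)))|%N ->
  (fidelity psi rho <= 1 - eps ->
     1 - delta <= prob_reject psi p q rho eps N /\
     prob_accept psi p q rho eps N <= delta) /\
  (rho = proj psi ->
     1 - delta <= prob_accept psi p q rho eps N /\
     prob_reject psi p q rho eps N <= delta).
Proof.
move=> /andP[r0 rn1] hpsi hrho hp hq /andP[e0 e1] /andP[d0 d1] nu nu0 NE.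
have rn : (r <= n)%N by apply: leq_trans rn1 (leq_subr _ _).
have nu1 : nu <= 1.
  rewrite /nu /spectral_gap gerBl; apply: lambda2_ge0.
    exact: strategy_herm.
  exact: strategy_psd.
(* Half the separation nu eps between the two means; nu <= 1 keeps it below 1/2, as the tail bounds
   require. *)
pose t := 2^-1 * nu * eps.
have ht : 0 <= t <= 2^-1 by rewrite /t; apply/andP; split; nra.
have lnd : 0 < ln delta^-1 by rewrite ln_gt0// invf_gt1.
set B := 2 ^+ (2 * r + 1) * (ln delta^-1 / (nu ^+ 2 * eps ^+ 2)) in NE.
have B0 : 0 < B by rewrite mulr_gt0 ?divr_gt0 ?mulr_gt0 ?exprn_gt0.
have NB : B <= N%:R.
  rewrite NE natr_absz ger0_norm; last by rewrite -(@ler_int R) (le_trans (ltW B0))// ceil_ge.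
  exact: ceil_ge.
have N0 : (0 < N)%N by rewrite -(ltr_nat R); apply: lt_le_trans NB.
have expd : expR (- (N%:R * (t ^+ 2 / (2 * 4 ^+ r.-1)))) <= delta.
  rewrite -[leRHS]lnK// ler_expR -[ln delta]opprK -lnV// lerN2.
  (* Here t^2 / (2 * 4^(r-1)) = nu^2 eps^2 / 2^(2r+1), the inverse of the factor of ln(1/delta) in
     [B]. *)
  have -> : ln delta^-1 = B * (t ^+ 2 / (2 * 4 ^+ r.-1)).
    rewrite /B /t; move: (ln _) => L; case: (r) r0 => // k _ /=.
    have -> : (2 * k.+1 + 1 = 2 * k + 3)%N by rewrite mulnS addnAC addnC addnA.
    rewrite exprD exprM (_ : 2 ^+ 2 = 4 :> R); last by rewrite -natrX.
    have : (4 : R) ^+ k != 0 by rewrite expf_neq0// pnatr_eq0.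
    move: (4 ^+ k) => x x0; field.
    by rewrite x0 !gt_eqF.
  rewrite ler_wpM2r// divr_ge0 ?sqr_ge0// mulr_ge0 ?exprn_ge0//.
have total : prob_accept psi p q rho eps N + prob_reject psi p q rho eps N = 1.
  rewrite -(expr1n R N) -(sum_run_prob rn hp hq hrho) -prod_distr_tuple.
  by rewrite [RHS](bigID (accepts psi p q eps (N := N))).
split=> [hF|hF].
  have acc : prob_accept psi p q rho eps N <= delta.
    apply: le_trans expd; apply: accept_upper_tail => //.
    apply: le_trans (trace_le_spectral_gap _ hpsi _ hrho nu0) _.
    - exact: strategy_herm.
    - exact: strategy_target.
    by rewrite -/nu /t; nra.
  by split=> //; rewrite -total lerBlDl lerD2r.
have rej : prob_reject psi p q rho eps N <= delta.
  apply: le_trans expd; apply: reject_lower_tail => //.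
  (* For [rho] = [proj psi] the mean is <psi|Omega|psi>, which is 1 because Omega fixes [psi]. *)
  rewrite hF mxtrace_mulC mxtrace_proj -mulmxA (strategy_target psi rn hp hq).
  by rewrite hpsi.
by split=> //; rewrite -total lerBlDr lerD2l.
Qed.
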